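(* For $s\in[0,1]$ and $\beta\in\mathbb{C}$ let $$F(s,\beta):=(2s-\beta)\sin(\pi(s-\beta))-\frac{\sin(\pi s)\,\Gamma(2s+1-\beta)\,\Gamma(\beta+1)}{\Gamma(2s)}.$$ Then there exist $\eta_1,\eta_2>0$ sufficiently small such that, for all $s\in[1-\eta_1,1]$ and, respectively, all $s\in[0,\eta_2]$, there exist $\beta_1(s)\in\mathbb{C}$ and, respectively, $\beta_2(s)\in\mathbb{C}$ satisfying $$F(s,\beta_1(s))=0\quad(s\in[1-\eta_1,1]),\qquad F(s,\beta_2(s))=0\quad(s\in[0,\eta_2]).$$ Moreover, it holds (for either choice of the sign $\pm$ there is such a $\beta_1$) $$\beta_1(s)=2\pm i\sqrt{2(1-s)}-3(1-s)+o(1-s)\ \text{ as }s\to1,\qquad\beta_2(s)=3s+o(s)\ \text{ as }s\to0.$$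
   Context: $\Gamma$ is the Euler Gamma function, with the convention $1/\Gamma(0)=0$. *)

(* Defs.v *)
From Stdlib Require Import Reals Lra Factorial.
From Coquelicot Require Import Coquelicot.
Open Scope R_scope.

Definition Cexp (z : C) : C :=
  (exp (Re z) * cos (Im z), exp (Re z) * sin (Im z)).

Definition Csin (z : C) : C :=
  ((Cexp (Ci * z) - Cexp (- (Ci * z))) / (2 * Ci))%C.

(* z (z + 1) ... (z + n - 1) *)
Fixpoint Crising (z : C) (n : nat) : C :=
  match n with
  | O => 1%C
  | S m => (Crising z m * (z + INR m))%C
  end.

Definition CLim_seq (u : nat -> C) : C :=
  (real (Lim_seq (fun n => Re (u n))), real (Lim_seq (fun n => Im (u n)))).

Definition Gamma_seq (z : C) (n : nat) : C :=
  (INR (fact n) * Cexp (z * ln (INR n)) / Crising z (S n))%C.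

(* Euler's definition  Gamma(z) = lim_n n! n^z / (z (z+1) ... (z+n)),
   valid on the whole complex plane minus the poles 0, -1, -2, ...
   At a pole the value is 0, because [/ 0 = 0]. *)
Definition Gamma (z : C) : C := CLim_seq (Gamma_seq z).

Definition Gamma_pole (z : C) : Prop := exists k : nat, z = (- INR k)%C.

Definition F (s : R) (beta : C) : C :=
  ((2 * s - beta) * Csin (PI * (s - beta))
   - Csin (PI * s) * Gamma (2 * s + 1 - beta) * Gamma (beta + 1)
     / Gamma (2 * s))%C.

(* The Gamma factors in the numerator of F are finite at (s, beta). The
   denominator is not restricted: Gamma (2 s) has a pole only at s = 0, where
   the convention 1 / Gamma(0) = 0 applies. *)
Definition F_defined (s : R) (beta : C) : Prop :=
  ~ Gamma_pole (2 * s + 1 - beta)%C /\ ~ Gamma_pole (beta + 1)%C.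

Lemma Cinv_0 : (/ 0)%C = 0%C.
Proof.
unfold Cinv, RtoC; simpl; apply injective_projections; simpl;
  unfold Rdiv; ring.
Qed.

(* The convention 1 / Gamma(0) = 0 holds for the definitions above. *)
Lemma Cinv_Gamma_0 : (/ Gamma 0)%C = 0%C.
Proof.
assert (H : forall n, Gamma_seq 0 n = 0%C).
{ intros n; unfold Gamma_seq, Cdiv.
  replace (Crising 0 (S n)) with (RtoC 0).
  - rewrite Cinv_0; ring.
  - induction n as [|n IH].
    + simpl; ring.
    + change (RtoC 0 = (Crising 0 (S n) * (0 + INR (S n)))%C).
      rewrite <- IH; ring. }
assert (E : Gamma 0 = 0%C).
{ unfold Gamma, CLim_seq.
  rewrite (Lim_seq_ext _ (fun _ => 0)) by (intros n; rewrite H; reflexivity).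
  rewrite (Lim_seq_ext (fun n => Im _) (fun _ => 0))
    by (intros n; rewrite H; reflexivity).
  rewrite Lim_seq_const; reflexivity. }
rewrite E; apply Cinv_0.
Qed.

(* f (s) = o(g (s)) as s -> a within D *)
Definition little_o (D : R -> Prop) (a : R) (f : R -> C) (g : R -> R) : Prop :=
  is_domin (U := R_NormedModule) (V := C_NormedModule)
    (within D (locally a)) g f.

(* Main.v *)
Require Import Defs.
From Stdlib Require Import Reals Lra Lia Factorial ClassicalEpsilon.
From Coquelicot Require Import Coquelicot.
Open Scope R_scope.

(** With [G z = Gamma (1 + z)], the recurrence of Gamma removes the pole of
    [Gamma (2 s)] at [s = 0] and turns [F] near [(0, 0)] and near [(1, 2)] into a
    combination of [sin (PI x)], [sin (PI s)] and values of [G] near [0].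
    Put [x = s - beta = s u] near [s = 0], and [beta = 2 - e + x], [e = 1 - s],
    [x = sqrt e * u] near [s = 1]. After division by the square of the scale,
    [F = 0] becomes a small Lipschitz perturbation of [(1 + u) u = 2] and of
    [u ^ 2 = - 2] respectively, both with simple roots. A Newton map with constant
    slope is then a contraction, and the distance from the approximate root [c] to
    the true one is at most twice the residual at [c]: [c = - 2] has residual [O(s)],
    and [c = +- i sqrt 2 - 2 sqrt e] has residual [O(e)].
    Euler's limit is turned into Gauss's infinite product, which gives convergence,
    the Lipschitz bound on [G], and [G z * G (- z) = 1 + O(z ^ 2)]. *)

(** The scales come from balancing leading terms. Near [(0, 0)] both terms of [F] are quadratic in
    [(s, x)], so [x] is proportional to [s]. Near [(1, 2)] the quadratic [x * (e + x)] stands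
    against [2 * e], so [x] has size [sqrt e], while the error allowed is [o(e)]: the approximate
    root must be right to second order in [sqrt e], and the part of the Gamma factors linear in [x]
    matters. The symmetric product of Gamma values contributes nothing to it, because the derivative
    of Gamma at 1, minus Euler's constant, enters with opposite signs; only the rational factors
    [(1 + x) * (2 + x)] from the recurrence contribute, namely [3 * x]. This is why Lipschitz bounds
    are enough and no derivative of Gamma is ever computed. The numerical constants are crude; every
    smallness requirement is met by shrinking the range of the parameter. *)

(** * Triangle inequalities for the complex modulus *)

Lemma Cmod_sub_le (x y : C) : Cmod (x - y) <= Cmod x + Cmod y.
Proof. rewrite <- (Cmod_opp y); apply Cmod_triangle. Qed.

Lemma Cmod_sub_sym (x y : C) : Cmod (x - y) = Cmod (y - x).
Proof. rewrite <- Cmod_opp; f_equal; ring. Qed.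

Lemma Cmod_sub_ge (x y : C) : Cmod x - Cmod y <= Cmod (x - y).
Proof.
assert (H := Cmod_triangle (x - y) y).
replace (x - y + y)%C with x in H by ring; lra.
Qed.

Lemma Cmod_add_ge (x y : C) : Cmod x - Cmod y <= Cmod (x + y).
Proof.
replace (x + y)%C with (x - - y)%C by ring.
rewrite <- (Cmod_opp y); apply Cmod_sub_ge.
Qed.

Lemma Cmod_gt_neq0 (x : C) : 0 < Cmod x -> x <> 0%C.
Proof. intros H; apply Cmod_gt_0; exact H. Qed.

Lemma Im_le_Cmod (z : C) : Rabs (Im z) <= Cmod z.
Proof. eapply Rle_trans; [apply Rmax_r | apply Rmax_Cmod]. Qed.

Lemma Cmod_le_Re_Im (z : C) : Cmod z <= Rabs (Re z) + Rabs (Im z).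
Proof.
replace z with (RtoC (Re z) + Ci * RtoC (Im z))%C at 1.
- eapply Rle_trans; [apply Cmod_triangle|].
  rewrite Cmod_mult, Cmod_Ci, !Cmod_R; lra.
- destruct z as [a b]; unfold Ci, Cplus, Cmult, RtoC; simpl.
  apply injective_projections; simpl; ring.
Qed.

(** * Explicit Taylor bounds for exponential and sine *)

(** One application of the mean value theorem raises the order of vanishing by one and keeps the
    constant. Each Taylor remainder below is the derivative of the next, up to sign, so all of them
    follow by climbing from order to order. *)
Lemma MVT_power_bound (f df : R -> R) (M : R) (k : nat) (a : R) :
  (forall t, is_derive f t (df t)) -> f 0 = 0 ->
  (forall t, Rabs t <= 1 -> Rabs (df t) <= M * Rabs t ^ k) ->
  0 <= M -> Rabs a <= 1 -> Rabs (f a) <= M * Rabs a ^ S k.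
Proof.
intros Hd H0 Hb HM Ha.
destruct (MVT_cor4 f df 0 1 (fun c _ => Hd c) a) as [c [E Hc]].
{ rewrite Rminus_0_r; exact Ha. }
rewrite !Rminus_0_r in Hc; rewrite H0, !Rminus_0_r in E.
rewrite E, Rabs_mult; simpl.
assert (Rabs (df c) <= M * Rabs a ^ k).
{ eapply Rle_trans; [apply Hb; lra|].
  apply Rmult_le_compat_l; [exact HM|]. apply pow_incr; split; [apply Rabs_pos|exact Hc]. }
replace (M * (Rabs a * Rabs a ^ k)) with ((M * Rabs a ^ k) * Rabs a) by ring.
apply Rmult_le_compat_r; [apply Rabs_pos|assumption].
Qed.

Lemma exp_taylor1 (a : R) : Rabs a <= 1 -> Rabs (exp a - 1) <= 3 * Rabs a ^ 1.
Proof.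
apply (MVT_power_bound (fun t => exp t - 1) exp 3 0).
- intros t; auto_derive; [trivial|ring].
- rewrite exp_0; ring.
- intros t Ht; rewrite Rabs_pos_eq by (left; apply exp_pos).
  apply Rabs_le_between in Ht.
  assert (exp t <= exp 1) by (destruct (Rle_lt_or_eq_dec t 1) as [h|h];
    [lra|left; apply exp_increasing; exact h|rewrite h; lra]).
  generalize exp_le_3; simpl; lra.
- lra.
Qed.

Lemma exp_taylor2 (a : R) : Rabs a <= 1 -> Rabs (exp a - 1 - a) <= 3 * Rabs a ^ 2.
Proof.
apply (MVT_power_bound (fun t => exp t - 1 - t) (fun t => exp t - 1) 3 1).
- intros t; auto_derive; [trivial|ring].
- rewrite exp_0; ring.
- apply exp_taylor1.
- lra.
Qed.

Lemma exp_taylor3 (a : R) :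
  Rabs a <= 1 -> Rabs (exp a - 1 - a - a ^ 2 / 2) <= 3 * Rabs a ^ 3.
Proof.
apply (MVT_power_bound (fun t => exp t - 1 - t - t ^ 2 / 2) (fun t => exp t - 1 - t) 3 2).
- intros t; auto_derive; [trivial|simpl; field].
- rewrite exp_0; field.
- apply exp_taylor2.
- lra.
Qed.

Lemma sin_taylor1 (b : R) : Rabs b <= 1 -> Rabs (sin b) <= 1 * Rabs b ^ 1.
Proof.
apply (MVT_power_bound sin cos 1 0).
- intros t; auto_derive; [trivial|ring].
- apply sin_0.
- intros t _; simpl; rewrite Rmult_1_r; apply Rabs_le, COS_bound.
- lra.
Qed.

Lemma cos_taylor2 (b : R) : Rabs b <= 1 -> Rabs (cos b - 1) <= 1 * Rabs b ^ 2.
Proof.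
apply (MVT_power_bound (fun t => cos t - 1) (fun t => - sin t) 1 1).
- intros t; auto_derive; [trivial|ring].
- rewrite cos_0; ring.
- intros t Ht; rewrite Rabs_Ropp; apply sin_taylor1, Ht.
- lra.
Qed.

Lemma sin_taylor3 (b : R) : Rabs b <= 1 -> Rabs (sin b - b) <= 1 * Rabs b ^ 3.
Proof.
apply (MVT_power_bound (fun t => sin t - t) (fun t => cos t - 1) 1 2).
- intros t; auto_derive; [trivial|ring].
- rewrite sin_0; ring.
- apply cos_taylor2.
- lra.
Qed.

Lemma cos_taylor4 (b : R) :
  Rabs b <= 1 -> Rabs (cos b - 1 + b ^ 2 / 2) <= 1 * Rabs b ^ 4.
Proof.
apply (MVT_power_bound (fun t => cos t - 1 + t ^ 2 / 2) (fun t => t - sin t) 1 3).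
- intros t; auto_derive; [trivial|simpl; field].
- rewrite cos_0; field.
- intros t Ht; rewrite Rabs_minus_sym; apply sin_taylor3, Ht.
- lra.
Qed.

Lemma Cexp_plus (z w : C) : Cexp (z + w) = (Cexp z * Cexp w)%C.
Proof.
destruct z as [a b], w as [c d]; unfold Cexp, Cplus, Cmult; simpl.
rewrite exp_plus, cos_plus, sin_plus; apply injective_projections; simpl; ring.
Qed.

Lemma Cexp_0 : Cexp 0 = 1%C.
Proof.
unfold Cexp, RtoC; simpl; rewrite exp_0, cos_0, sin_0.
apply injective_projections; simpl; ring.
Qed.

Lemma Cexp_R (x : R) : Cexp x = RtoC (exp x).
Proof.
unfold Cexp, RtoC; simpl; rewrite cos_0, sin_0; apply injective_projections; simpl; ring.
Qed.

(** Real and imaginary parts are treated apart: [(a ^ 2 - b ^ 2) / 2] and [a * b] are those of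
    [z * z / 2]. Each part costs 10. *)
Lemma Cexp_taylor3 (z : C) :
  Cmod z <= 1 -> Cmod (Cexp z - 1 - z - z * z / 2) <= 20 * Cmod z ^ 3.
Proof.
intros Hz.
assert (Ha := re_le_Cmod z); assert (Hb := Im_le_Cmod z).
assert (Hp := Cmod_ge_0 z); set (r := Cmod z) in *.
destruct z as [a b]; simpl in Ha, Hb.
assert (Aa := Rabs_pos a); assert (Ab := Rabs_pos b).
eapply Rle_trans; [apply Cmod_le_Re_Im|].
assert (r2 : r ^ 2 <= r) by nra.
assert (r3 : 0 <= r ^ 3) by (apply pow_le; lra).
assert (P : forall x k, 0 <= x <= r -> x ^ k <= r ^ k) by (intros; apply pow_incr; lra).
assert (Ea2 : Rabs (exp a - 1 - a) <= 3 * r ^ 2).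
{ eapply Rle_trans; [apply exp_taylor2; lra|].
  assert (h := P (Rabs a) 2%nat (conj Aa Ha)); lra. }
assert (Ea3 : Rabs (exp a - 1 - a - a ^ 2 / 2) <= 3 * r ^ 3).
{ eapply Rle_trans; [apply exp_taylor3; lra|].
  assert (h := P (Rabs a) 3%nat (conj Aa Ha)); lra. }
assert (Eb1 : Rabs (sin b) <= r).
{ eapply Rle_trans; [apply sin_taylor1; lra|]; lra. }
assert (Eb3 : Rabs (sin b - b) <= r ^ 3).
{ eapply Rle_trans; [apply sin_taylor3; lra|].
  assert (h := P (Rabs b) 3%nat (conj Ab Hb)); lra. }
assert (Eb4 : Rabs (cos b - 1 + b ^ 2 / 2) <= r ^ 3).
{ eapply Rle_trans; [apply cos_taylor4; lra|].
  assert (h := P (Rabs b) 4%nat (conj Ab Hb)); simpl in *; nra. }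
assert (a2 : a ^ 2 <= r ^ 2) by (rewrite <- (pow2_abs a); apply P; lra).
assert (b2 : b ^ 2 <= r ^ 2) by (rewrite <- (pow2_abs b); apply P; lra).
assert (cb : Rabs (cos b) <= 1) by (apply Rabs_le, COS_bound).
assert (a20 := pow2_ge_0 a); assert (b20 := pow2_ge_0 b).
assert (R1 : Rabs (exp a * cos b - 1 - a - (a ^ 2 - b ^ 2) / 2) <= 10 * r ^ 3).
(* With [T = 1 + a + a ^ 2 / 2], the remainder of [exp] multiplies [cos b], that of [cos] multiplies
   [T], and the leftover [(T - 1) * b ^ 2 / 2] is already cubic. *)
{ replace (exp a * cos b - 1 - a - (a ^ 2 - b ^ 2) / 2) with
    ((exp a - 1 - a - a ^ 2 / 2) * cos b
     + ((1 + a + a ^ 2 / 2) * (cos b - 1 + b ^ 2 / 2)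
        + - ((a + a ^ 2 / 2) * (b ^ 2 / 2)))) by field.
  assert (T1 : Rabs (1 + a + a ^ 2 / 2) <= 5 / 2).
  { apply Rabs_le_between in Ha; apply Rabs_le; lra. }
  assert (T2 : Rabs (a + a ^ 2 / 2) <= 3 / 2 * r).
  { apply Rabs_le_between in Ha; apply Rabs_le; lra. }
  assert (T3 : Rabs (b ^ 2 / 2) <= r ^ 2) by (rewrite Rabs_pos_eq; lra).
  eapply Rle_trans; [apply Rabs_triang|].
  eapply Rle_trans; [apply Rplus_le_compat_l, Rabs_triang|].
  rewrite Rabs_Ropp, !Rabs_mult.
  assert (U1 := Rmult_le_compat _ _ _ _ (Rabs_pos _) (Rabs_pos _) Ea3 cb).
  assert (U2 := Rmult_le_compat _ _ _ _ (Rabs_pos _) (Rabs_pos _) T1 Eb4).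
  assert (U3 := Rmult_le_compat _ _ _ _ (Rabs_pos _) (Rabs_pos _) T2 T3).
  simpl in *; lra. }
assert (R2 : Rabs (exp a * sin b - b - a * b) <= 10 * r ^ 3).
{ replace (exp a * sin b - b - a * b) with
    ((exp a - 1 - a) * sin b + (1 + a) * (sin b - b)) by ring.
  assert (T1 : Rabs (1 + a) <= 2).
  { apply Rabs_le_between in Ha; apply Rabs_le; lra. }
  eapply Rle_trans; [apply Rabs_triang|]; rewrite !Rabs_mult.
  assert (U1 := Rmult_le_compat _ _ _ _ (Rabs_pos _) (Rabs_pos _) Ea2 Eb1).
  assert (U2 := Rmult_le_compat _ _ _ _ (Rabs_pos _) (Rabs_pos _) T1 Eb3).
  simpl in *; lra. }
match goal with |- Rabs ?x + Rabs ?y <= _ =>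
  replace x with (exp a * cos b - 1 - a - (a ^ 2 - b ^ 2) / 2) by
    (unfold Cexp, Cminus, Cdiv, Cinv, Cmult, Cplus, Copp, RtoC; simpl; field);
  replace y with (exp a * sin b - b - a * b) by
    (unfold Cexp, Cminus, Cdiv, Cinv, Cmult, Cplus, Copp, RtoC; simpl; field)
end.
lra.
Qed.

Lemma Cexp_taylor2 (z : C) :
  Cmod z <= 1 -> Cmod (Cexp z - 1 - z) <= 21 * Cmod z ^ 2.
Proof.
intros Hz; assert (H := Cexp_taylor3 z Hz); assert (Hp := Cmod_ge_0 z).
replace (Cexp z - 1 - z)%C with ((Cexp z - 1 - z - z * z / 2) + z * z / 2)%C by ring.
eapply Rle_trans; [apply Cmod_triangle|].
rewrite (Cmod_div (z * z)), Cmod_mult, (Cmod_R 2), (Rabs_pos_eq 2)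
  by (lra || (apply Cmod_gt_neq0; rewrite Cmod_R, Rabs_pos_eq; lra)).
assert (Cmod z ^ 3 <= Cmod z ^ 2) by (simpl; nra).
assert (0 <= Cmod z ^ 2) by apply pow2_ge_0.
lra.
Qed.

Lemma Cexp_taylor1 (z : C) : Cmod z <= 1 -> Cmod (Cexp z - 1) <= 22 * Cmod z.
Proof.
intros Hz; assert (H := Cexp_taylor2 z Hz); assert (Hp := Cmod_ge_0 z).
replace (Cexp z - 1)%C with ((Cexp z - 1 - z) + z)%C by ring.
eapply Rle_trans; [apply Cmod_triangle|].
nra.
Qed.

Lemma Ci_neq0 : Ci <> 0%C.
Proof. apply Cmod_gt_neq0; rewrite Cmod_Ci; lra. Qed.

Lemma two_Ci_neq0 : (2 * Ci)%C <> 0%C.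
Proof. apply Cmod_gt_neq0; rewrite Cmod_mult, Cmod_Ci, Cmod_R, Rabs_pos_eq; lra. Qed.

Lemma Ci_sqr : (Ci * Ci = -1)%C.
Proof. unfold Ci, Cmult, RtoC; apply injective_projections; simpl; ring. Qed.

Lemma Cmod_2Ci : Cmod (2 * Ci) = 2.
Proof. rewrite Cmod_mult, Cmod_Ci, Cmod_R, Rabs_pos_eq; lra. Qed.

(** The even terms of the two exponentials cancel in the difference, so only their cubic remainders
    survive. *)
Lemma Csin_cubic (x : C) : Cmod x <= 1 -> Cmod (Csin x - x) <= 20 * Cmod x ^ 3.
Proof.
intros Hx.
assert (H1 := Cexp_taylor3 (Ci * x)); assert (H2 := Cexp_taylor3 (- (Ci * x))).
rewrite ?Cmod_opp, Cmod_mult, Cmod_Ci, Rmult_1_l in H1.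
rewrite ?Cmod_opp, Cmod_mult, Cmod_Ci, Rmult_1_l in H2.
specialize (H1 Hx); specialize (H2 Hx).
unfold Csin.
replace ((Cexp (Ci * x) - Cexp (- (Ci * x))) / (2 * Ci) - x)%C with
  (((Cexp (Ci * x) - 1 - Ci * x - Ci * x * (Ci * x) / 2)
   - (Cexp (- (Ci * x)) - 1 - - (Ci * x) - - (Ci * x) * - (Ci * x) / 2)) / (2 * Ci))%C
  by (field; apply Ci_neq0).
rewrite Cmod_div, Cmod_2Ci by apply two_Ci_neq0.
match goal with |- Cmod (?p - ?q) / 2 <= _ => assert (h := Cmod_sub_le p q) end.
lra.
Qed.

(** The sine minus the identity has a small Lipschitz constant near 0, which is the form a
    contraction argument needs. With [d = x - y], each exponential is handled by factoring
    [Cexp (i * y)] out of the difference, for [i] equal to [Ci] and to [- Ci]. *)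
Lemma Csin_near_identity (x y : C) :
  Cmod x <= 1 / 2 -> Cmod y <= 1 / 2 ->
  Cmod (Csin x - Csin y - (x - y)) <= 600 * (Cmod x + Cmod y) * Cmod (x - y).
Proof.
intros Hx Hy.
assert (Hd := Cmod_sub_le x y).
assert (Key : forall i : C, Cmod i = 1 ->
  Cmod (Cexp (i * x) - Cexp (i * y) - i * (x - y))
    <= 600 * (Cmod x + Cmod y) * Cmod (x - y)).
{ intros i Hi; set (d := (x - y)%C) in *.
  assert (Hid : Cmod (i * d) = Cmod d) by (rewrite Cmod_mult, Hi; ring).
  assert (Hiy : Cmod (i * y) = Cmod y) by (rewrite Cmod_mult, Hi; ring).
  replace (i * x)%C with (i * y + i * d)%C by (unfold d; ring).
  rewrite Cexp_plus.
  replace (Cexp (i * y) * Cexp (i * d) - Cexp (i * y) - i * d)%C with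
    ((Cexp (i * y) - 1) * (Cexp (i * d) - 1) + (Cexp (i * d) - 1 - i * d))%C by ring.
  eapply Rle_trans; [apply Cmod_triangle|]; rewrite Cmod_mult.
  assert (h1 := Cexp_taylor1 (i * y)); assert (h2 := Cexp_taylor1 (i * d)).
  assert (h3 := Cexp_taylor2 (i * d)).
  rewrite Hid in h2, h3; rewrite Hiy in h1.
  specialize (h1 ltac:(lra)); specialize (h2 ltac:(lra)); specialize (h3 ltac:(lra)).
  assert (U := Rmult_le_compat _ _ _ _ (Cmod_ge_0 _) (Cmod_ge_0 _) h1 h2).
  assert (p1 := Cmod_ge_0 d); assert (p2 := Cmod_ge_0 x); assert (p3 := Cmod_ge_0 y).
  assert (Cmod d ^ 2 <= (Cmod x + Cmod y) * Cmod d) by (simpl; nra).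
  nra. }
assert (H1 := Key Ci Cmod_Ci).
assert (H2 := Key (- Ci)%C ltac:(rewrite Cmod_opp; apply Cmod_Ci)).
unfold Csin.
replace ((Cexp (Ci * x) - Cexp (- (Ci * x))) / (2 * Ci)
  - (Cexp (Ci * y) - Cexp (- (Ci * y))) / (2 * Ci) - (x - y))%C with
  (((Cexp (Ci * x) - Cexp (Ci * y) - Ci * (x - y))
   - (Cexp (- Ci * x) - Cexp (- Ci * y) - - Ci * (x - y))) / (2 * Ci))%C.
- rewrite Cmod_div, Cmod_2Ci by apply two_Ci_neq0.
  match goal with |- Cmod (?p - ?q) / 2 <= _ => assert (h := Cmod_sub_le p q) end.
  lra.
- replace (- Ci * x)%C with (- (Ci * x))%C by ring.
  replace (- Ci * y)%C with (- (Ci * y))%C by ring.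
  field; apply Ci_neq0.
Qed.

Lemma Csin_opp (z : C) : Csin (- z) = (- Csin z)%C.
Proof.
unfold Csin; replace (Ci * - z)%C with (- (Ci * z))%C by ring.
replace (- - (Ci * z))%C with (Ci * z)%C by ring; unfold Cdiv; ring.
Qed.

Lemma Cexp_pi (z : C) : Cexp (z + Ci * PI) = (- Cexp z)%C.
Proof.
rewrite Cexp_plus.
replace (Cexp (Ci * PI)) with (RtoC (-1)); [ring|].
unfold Cexp, Ci, Cmult, RtoC; apply injective_projections; simpl.
- replace (0 * PI - 1 * 0) with 0 by ring; replace (0 * 0 + 1 * PI) with PI by ring.
  rewrite exp_0, cos_PI; ring.
- replace (0 * PI - 1 * 0) with 0 by ring; replace (0 * 0 + 1 * PI) with PI by ring.
  rewrite exp_0, sin_PI; ring.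
Qed.

Lemma Csin_plus_pi (z : C) : Csin (z + PI) = (- Csin z)%C.
Proof.
unfold Csin.
replace (Ci * (z + PI))%C with (Ci * z + Ci * PI)%C by ring.
replace (- (Ci * z))%C with (- (Ci * z + Ci * PI) + Ci * PI)%C by ring.
rewrite !Cexp_pi; unfold Cdiv; ring.
Qed.

Lemma Csin_0 : Csin 0 = 0%C.
Proof.
unfold Csin; replace (- (Ci * 0))%C with (Ci * 0)%C by ring; unfold Cdiv; ring.
Qed.

(** * Convergence of complex sequences *)

(** Stated through the modulus so that squeeze and limit rules for real sequences apply directly. *)
Definition Ccv (u : nat -> C) (l : C) : Prop :=
  is_lim_seq (fun n => Cmod (u n - l)) 0.

Lemma Ccv_Re (u : nat -> C) (l : C) : Ccv u l -> is_lim_seq (fun n => Re (u n)) (Re l).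
Proof.
intros H; apply is_lim_seq_spec; apply is_lim_seq_spec in H.
intros eps; destruct (H eps) as [N HN]; exists N; intros n Hn.
specialize (HN n Hn); rewrite Rminus_0_r, Rabs_pos_eq in HN by apply Cmod_ge_0.
eapply Rle_lt_trans; [|exact HN].
eapply Rle_trans; [|apply re_le_Cmod]; right; f_equal; unfold Cminus; destruct (u n), l; reflexivity.
Qed.

Lemma Ccv_Im (u : nat -> C) (l : C) : Ccv u l -> is_lim_seq (fun n => Im (u n)) (Im l).
Proof.
intros H; apply is_lim_seq_spec; apply is_lim_seq_spec in H.
intros eps; destruct (H eps) as [N HN]; exists N; intros n Hn.
specialize (HN n Hn); rewrite Rminus_0_r, Rabs_pos_eq in HN by apply Cmod_ge_0.
eapply Rle_lt_trans; [|exact HN].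
eapply Rle_trans; [|apply Im_le_Cmod]; right; f_equal; unfold Cminus; destruct (u n), l; reflexivity.
Qed.

(** [CLim_seq] returns some value even on a divergent sequence, so each value of [Gamma] below is
    read off through this lemma, from a proof of convergence. *)
Lemma CLim_seq_unique (u : nat -> C) (l : C) : Ccv u l -> CLim_seq u = l.
Proof.
intros H; unfold CLim_seq.
rewrite (is_lim_seq_unique _ _ (Ccv_Re _ _ H)), (is_lim_seq_unique _ _ (Ccv_Im _ _ H)).
destruct l; reflexivity.
Qed.

Lemma Ccv_unique (u : nat -> C) (l l' : C) : Ccv u l -> Ccv u l' -> l = l'.
Proof. intros H H'; rewrite <- (CLim_seq_unique _ _ H); apply CLim_seq_unique, H'. Qed.

Lemma Ccv_squeeze (u : nat -> C) (l : C) (t : nat -> R) (N : nat) :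
  (forall n, (N <= n)%nat -> Cmod (u n - l) <= t n) -> is_lim_seq t 0 -> Ccv u l.
Proof.
intros H Ht; apply (is_lim_seq_le_le_loc (fun _ => 0) _ t).
- exists N; intros n Hn; split; [apply Cmod_ge_0|auto].
- apply is_lim_seq_const.
- exact Ht.
Qed.

Lemma Ccv_const (l : C) : Ccv (fun _ => l) l.
Proof.
apply (Ccv_squeeze _ _ (fun _ => 0) 0); [|apply is_lim_seq_const].
intros n _; replace (l - l)%C with (RtoC 0) by ring; rewrite Cmod_0; lra.
Qed.

Lemma Ccv_ext_ge (u v : nat -> C) (l : C) (N : nat) :
  (forall n, (N <= n)%nat -> u n = v n) -> Ccv u l -> Ccv v l.
Proof.
intros E H; apply (Ccv_squeeze _ _ (fun n => Cmod (u n - l)) N); [|exact H].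
intros n Hn; rewrite (E n Hn); lra.
Qed.

Lemma Ccv_Cmod (u : nat -> C) (l : C) : Ccv u l -> is_lim_seq (fun n => Cmod (u n)) (Cmod l).
Proof.
intros H; apply (is_lim_seq_le_le (fun n => Cmod l - Cmod (u n - l)) _ (fun n => Cmod l + Cmod (u n - l))).
- intros n; split.
  + rewrite Cmod_sub_sym; assert (h := Cmod_sub_ge l (l - u n)).
    replace (l - (l - u n))%C with (u n) in h by ring; lra.
  + assert (h := Cmod_triangle l (u n - l)).
    replace (l + (u n - l))%C with (u n) in h by ring; lra.
- replace (Finite (Cmod l)) with (Finite (Cmod l - 0)) by (f_equal; ring).
  apply is_lim_seq_minus'; [apply is_lim_seq_const|exact H].
- replace (Finite (Cmod l)) with (Finite (Cmod l + 0)) by (f_equal; ring).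
  apply is_lim_seq_plus'; [apply is_lim_seq_const|exact H].
Qed.

Lemma Ccv_plus (u v : nat -> C) (l m : C) :
  Ccv u l -> Ccv v m -> Ccv (fun n => u n + v n)%C (l + m).
Proof.
intros Hu Hv; apply (Ccv_squeeze _ _ (fun n => Cmod (u n - l) + Cmod (v n - m)) 0).
- intros n _; replace (u n + v n - (l + m))%C with ((u n - l) + (v n - m))%C by ring.
  apply Cmod_triangle.
- replace (Finite 0) with (Finite (0 + 0)) by (f_equal; ring).
  apply is_lim_seq_plus'; assumption.
Qed.

Lemma Ccv_mult (u v : nat -> C) (l m : C) :
  Ccv u l -> Ccv v m -> Ccv (fun n => u n * v n)%C (l * m).
Proof.
intros Hu Hv.
apply (Ccv_squeeze _ _ (fun n => Cmod (u n) * Cmod (v n - m) + Cmod (u n - l) * Cmod m) 0).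
- intros n _.
  replace (u n * v n - l * m)%C with (u n * (v n - m) + (u n - l) * m)%C by ring.
  eapply Rle_trans; [apply Cmod_triangle|]; rewrite !Cmod_mult; lra.
- replace (Finite 0) with (Finite (Cmod l * 0 + 0 * Cmod m)) by (f_equal; ring).
  apply is_lim_seq_plus'; apply is_lim_seq_mult';
    [apply Ccv_Cmod, Hu | exact Hv | exact Hu | apply is_lim_seq_const].
Qed.

Lemma Ccv_opp (u : nat -> C) (l : C) : Ccv u l -> Ccv (fun n => - u n)%C (- l).
Proof.
intros H; apply (Ccv_squeeze _ _ (fun n => Cmod (u n - l)) 0); [|exact H].
intros n _; rewrite <- Cmod_opp; right; f_equal; ring.
Qed.

Lemma Ccv_Cmod_le (u : nat -> C) (l : C) (B : R) :
  Ccv u l -> (forall n, Cmod (u n) <= B) -> Cmod l <= B.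
Proof.
intros H HB.
apply (is_lim_seq_le (fun n => Cmod (u n)) (fun _ => B) (Cmod l) B HB).
- apply Ccv_Cmod, H.
- apply is_lim_seq_const.
Qed.

(** A Cauchy criterion with an explicit tail: summing the increments telescopes, so the distance
    from index [n] onward is at most [t n]. It serves the infinite products with [t] of order
    [1 / n] and the fixed point iteration with [t] geometric. *)
Lemma ex_Ccv_telescope (u : nat -> C) (t : nat -> R) :
  (forall n, Cmod (u (S n) - u n) <= t n - t (S n)) -> is_lim_seq t 0 ->
  exists l, Ccv u l /\ Cmod (l - u 0%nat) <= t 0%nat.
Proof.
intros H Ht.
assert (H1 : forall n k, Cmod (u (n + k)%nat - u n) <= t n - t (n + k)%nat).
{ intros n k; induction k as [|k IH].
  - rewrite Nat.add_0_r; replace (u n - u n)%C with (RtoC 0) by ring; rewrite Cmod_0; lra.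
  - rewrite Nat.add_succ_r.
    replace (u (S (n + k)) - u n)%C with ((u (S (n + k)) - u (n + k)%nat) + (u (n + k)%nat - u n))%C by ring.
    eapply Rle_trans; [apply Cmod_triangle|]; specialize (H (n + k)%nat); lra. }
assert (Hd : forall n, t (S n) <= t n).
{ intros n; specialize (H n); generalize (Cmod_ge_0 (u (S n) - u n)); lra. }
assert (Hp : forall n, 0 <= t n).
{ intros n; apply (is_lim_seq_decr_compare t 0 Ht Hd). }
assert (H2 : forall n m, (n <= m)%nat -> Cmod (u m - u n) <= t n).
{ intros n m Hm; specialize (H1 n (m - n)%nat).
  replace (n + (m - n))%nat with m in H1 by lia; specialize (Hp m); lra. }
(* [p] stands for [Re] and [Im], both 1-Lipschitz; completeness of the reals is applied to each. *)
assert (Cau : forall p : C -> R, (forall a b, Rabs (p a - p b) <= Cmod (a - b)) ->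
  ex_finite_lim_seq (fun n => p (u n))).
{ intros p Hpp; apply ex_lim_seq_cauchy_corr; intros eps.
  apply is_lim_seq_spec in Ht.
  destruct (Ht (mkposreal _ (is_pos_div_2 eps))) as [N HN]; exists N; intros n m Hn Hm.
  assert (h1 := H2 _ _ Hn); assert (h2 := H2 _ _ Hm).
  specialize (HN N (Nat.le_refl _)); simpl in HN.
  rewrite Rminus_0_r, Rabs_pos_eq in HN by apply Hp.
  assert (q1 := Hpp (u n) (u N)); assert (q2 := Hpp (u N) (u m)).
  rewrite (Cmod_sub_sym (u N)) in q2.
  replace (p (u n) - p (u m)) with ((p (u n) - p (u N)) + (p (u N) - p (u m))) by ring.
  eapply Rle_lt_trans; [apply Rabs_triang|]; lra. }
destruct (Cau Re) as [a Ha].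
{ intros x y; eapply Rle_trans; [|apply re_le_Cmod]; right; f_equal; destruct x, y; reflexivity. }
destruct (Cau Im) as [b Hb].
{ intros x y; eapply Rle_trans; [|apply Im_le_Cmod]; right; f_equal; destruct x, y; reflexivity. }
assert (Hl : Ccv u (a, b)).
{ apply (Ccv_squeeze _ _ (fun n => Rabs (Re (u n) - a) + Rabs (Im (u n) - b)) 0).
  - intros n _; eapply Rle_trans; [apply Cmod_le_Re_Im|]; right; f_equal; destruct (u n); reflexivity.
  - replace (Finite 0) with (Finite (Rabs (a - a) + Rabs (b - b))).
    + apply is_lim_seq_plus'; apply (is_lim_seq_abs _ (Finite _));
        apply is_lim_seq_minus'; auto using is_lim_seq_const.
    + f_equal; rewrite !Rminus_diag, !Rabs_R0; ring. }
exists (a, b); split; [exact Hl|].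
apply (Ccv_Cmod_le (fun n => u n + - u 0%nat)%C).
- apply Ccv_plus; [exact Hl|apply Ccv_const].
- intros n; apply H2; lia.
Qed.

(** * Infinite products with factors close to 1 *)

Lemma inv_INR_S_lim : is_lim_seq (fun n => / INR (S n)) 0.
Proof.
replace (Finite 0) with (Rbar_inv p_infty) by reflexivity.
apply is_lim_seq_inv; [|discriminate].
apply -> (is_lim_seq_incr_1 INR); apply is_lim_seq_INR.
Qed.

(** A telescoping substitute for the inverse square: its partial sums are [1 - 1 / (n + 1)], so
    summability comes for free. *)
Definition inv_gap (n : nat) : R := / INR (S n) - / INR (S (S n)).

Lemma inv_gap_eq (n : nat) : inv_gap n = / (INR (S n) * INR (S (S n))).
Proof.
unfold inv_gap; rewrite (S_INR (S n)); assert (h := lt_0_INR (S n) ltac:(lia)).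
field; lra.
Qed.

Lemma inv_gap_pos (n : nat) : 0 < inv_gap n.
Proof.
rewrite inv_gap_eq; apply Rinv_0_lt_compat, Rmult_lt_0_compat; apply lt_0_INR; lia.
Qed.

Fixpoint Cprod (r : nat -> C -> C) (n : nat) (x : C) : C :=
  match n with
  | O => 1%C
  | S m => (Cprod r m x * r m x)%C
  end.

Section Product.
Variables (r : nat -> C -> C) (A : R).
Hypothesis r_at_0 : forall n, r n 0 = 1%C.
Hypothesis r_lip : forall n x y, Cmod x <= 1 / 2 -> Cmod y <= 1 / 2 ->
  Cmod (r n x - r n y) <= A * inv_gap n * Cmod (x - y).
Hypothesis A_ge0 : 0 <= A.

(** Closed form of the sum of [A * inv_gap k] for [k < n]. Then [exp (s n)] dominates the product of
    the [1 + A * inv_gap k]. *)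
Let s (n : nat) := A * (1 - / INR (S n)).

Lemma s_succ n : s (S n) = s n + A * inv_gap n.
Proof. unfold s, inv_gap; ring. Qed.

Lemma s_ge0 n : 0 <= s n.
Proof.
induction n as [|n IH].
- unfold s; simpl; lra.
- rewrite s_succ; assert (h := inv_gap_pos n); nra.
Qed.

Lemma s_leA n : s n <= A.
Proof.
unfold s; assert (h := Rinv_0_lt_compat _ (lt_0_INR (S n) ltac:(lia))); nra.
Qed.

Lemma factor_sub1 n x : Cmod x <= 1 / 2 -> Cmod (r n x - 1) <= A * inv_gap n.
Proof.
intros Hx; rewrite <- (r_at_0 n).
eapply Rle_trans; [apply r_lip; [exact Hx|rewrite Cmod_0; lra]|].
replace (x - 0)%C with x by ring.
assert (h := inv_gap_pos n); assert (0 <= A * inv_gap n) by nra; nra.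
Qed.

Lemma factor_le n x : Cmod x <= 1 / 2 -> Cmod (r n x) <= 1 + A * inv_gap n.
Proof.
intros Hx; assert (h := Cmod_triangle (r n x - 1) 1).
replace (r n x - 1 + 1)%C with (r n x) in h by ring.
rewrite Cmod_1 in h; assert (h' := factor_sub1 n x Hx); lra.
Qed.

Lemma exp_s_succ n : exp (s n) * (1 + A * inv_gap n) <= exp (s (S n)).
Proof.
rewrite s_succ, exp_plus; apply Rmult_le_compat_l; [left; apply exp_pos|apply exp_ineq1_le].
Qed.

Lemma Cprod_le n x : Cmod x <= 1 / 2 -> Cmod (Cprod r n x) <= exp (s n).
Proof.
intros Hx; induction n as [|n IH].
- simpl; rewrite Cmod_1; unfold s; simpl; replace (A * (1 - / 1)) with 0 by field.
  rewrite exp_0; lra.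
- simpl; rewrite Cmod_mult; eapply Rle_trans; [|apply exp_s_succ].
  apply Rmult_le_compat; auto using Cmod_ge_0, factor_le.
Qed.

(** Induction by the product rule. With [h = A * inv_gap n], the bound reproduces itself because
    [exp s * s * (1 + h) + exp s * h] is at most [exp (s + h) * (s + h)]. *)
Lemma Cprod_lip_n n x y : Cmod x <= 1 / 2 -> Cmod y <= 1 / 2 ->
  Cmod (Cprod r n x - Cprod r n y) <= exp (s n) * s n * Cmod (x - y).
Proof.
intros Hx Hy; induction n as [|n IH].
- simpl; replace (1 - 1)%C with (RtoC 0) by ring; rewrite Cmod_0.
  unfold s; simpl; replace (A * (1 - / 1)) with 0 by field; lra.
- simpl.
  replace (Cprod r n x * r n x - Cprod r n y * r n y)%C with
   ((Cprod r n x - Cprod r n y) * r n x + Cprod r n y * (r n x - r n y))%C by ring.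
  eapply Rle_trans; [apply Cmod_triangle|]; rewrite !Cmod_mult.
  assert (h1 := Rmult_le_compat _ _ _ _ (Cmod_ge_0 _) (Cmod_ge_0 _) IH (factor_le n x Hx)).
  assert (h2 := Rmult_le_compat _ _ _ _ (Cmod_ge_0 _) (Cmod_ge_0 _) (Cprod_le n y Hy) (r_lip n x y Hx Hy)).
  assert (d := inv_gap_pos n); assert (Ad : 0 <= A * inv_gap n) by nra.
  assert (p := Cmod_ge_0 (x - y)); assert (e := exp_pos (s n)).
  assert (g := exp_s_succ n); assert (q := s_ge0 n).
  assert (exp (s n) <= exp (s (S n))) by nra.
  rewrite (s_succ n) at 2.
  set (D := Cmod (x - y)) in *.
  assert (exp (s n) * (1 + A * inv_gap n) * (s n * D) <= exp (s (S n)) * (s n * D))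
    by (apply Rmult_le_compat_r; nra).
  assert (exp (s n) * (A * inv_gap n * D) <= exp (s (S n)) * (A * inv_gap n * D))
    by (apply Rmult_le_compat_r; nra).
  lra.
Qed.

Lemma exp_s_le n : exp (s n) <= exp A.
Proof.
destruct (Rle_lt_or_eq_dec _ _ (s_leA n)) as [h|h]; [left; apply exp_increasing, h|rewrite h; lra].
Qed.

(** The increment of the product is the product times [r n x - 1], hence at most
    [exp A * A * inv_gap n], which telescopes. The Lipschitz bound is uniform in [n] and survives
    the limit. *)
Lemma ex_Cprod_limit :
  exists g : C -> C, g 0%C = 1%C /\
    (forall x, Cmod x <= 1 / 2 -> Ccv (fun n => Cprod r n x) (g x)) /\
    (forall x y, Cmod x <= 1 / 2 -> Cmod y <= 1 / 2 ->
       Cmod (g x - g y) <= exp A * A * Cmod (x - y)).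
Proof.
assert (Hcv : forall x, Cmod x <= 1 / 2 ->
  Ccv (fun n => Cprod r n x) (CLim_seq (fun n => Cprod r n x))).
{ intros x Hx.
  destruct (ex_Ccv_telescope (fun n => Cprod r n x) (fun n => exp A * A * / INR (S n)))
    as [l [Hl _]].
  - intros n; simpl Cprod.
    replace (Cprod r n x * r n x - Cprod r n x)%C with (Cprod r n x * (r n x - 1))%C by ring.
    rewrite Cmod_mult.
    replace (exp A * A * / INR (S n) - exp A * A * / INR (S (S n)))
      with (exp A * (A * inv_gap n)) by (unfold inv_gap; ring).
    apply Rmult_le_compat; try apply Cmod_ge_0; [|apply factor_sub1, Hx].
    eapply Rle_trans; [apply Cprod_le, Hx|apply exp_s_le].
  - replace (Finite 0) with (Finite (exp A * A * 0)) by (f_equal; ring).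
    apply is_lim_seq_mult'; [apply is_lim_seq_const|apply inv_INR_S_lim].
  - rewrite (CLim_seq_unique _ _ Hl); exact Hl. }
exists (fun x => CLim_seq (fun n => Cprod r n x)); split; [|split].
- apply CLim_seq_unique; apply (Ccv_ext_ge (fun _ => 1%C) _ _ 0); [|apply Ccv_const].
  intros n _; induction n as [|n IH]; simpl; [reflexivity|].
  rewrite <- IH, r_at_0; ring.
- exact Hcv.
- intros x y Hx Hy.
  apply (Ccv_Cmod_le (fun n => Cprod r n x + - Cprod r n y)%C).
  + apply Ccv_plus; [|apply Ccv_opp]; apply Hcv; assumption.
  + intros n; eapply Rle_trans; [apply Cprod_lip_n; assumption|].
    apply Rmult_le_compat_r; [apply Cmod_ge_0|].
    apply Rmult_le_compat; [left; apply exp_pos|apply s_ge0|apply exp_s_le|apply s_leA].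
Qed.
End Product.

(** * The factors of Gauss's product *)

Definition dln (n : nat) : R := ln (INR (S (S n))) - ln (INR (S n)).

(* Gauss's product: Gamma (1 + z) = prod_(m >= 1) (1 + 1/m)^z / (1 + z/m), with m = n + 1. *)
Definition gauss_factor (n : nat) (z : C) : C :=
  (Cexp (z * dln n) / (1 + z / INR (S n)))%C.

Lemma ln_le_sub1 (x : R) : 0 < x -> ln x <= x - 1.
Proof. intros Hx; assert (h := exp_ineq1_le (ln x)); rewrite exp_ln in h by exact Hx; lra. Qed.

Lemma INR_S_ge1 (n : nat) : 1 <= INR (S n).
Proof. rewrite S_INR; generalize (pos_INR n); lra. Qed.

(** Both sides are [ln x <= x - 1], at [m / (m + 1)] and at [(m + 1) / m]. The two bounds differ by
    exactly [inv_gap n], so [dln n] is within [inv_gap n] of [/ INR (S n)]. *)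
Lemma dln_bounds (n : nat) : / INR (S (S n)) <= dln n <= / INR (S n).
Proof.
assert (p := INR_S_ge1 n); rewrite (S_INR (S n)) in *.
unfold dln; rewrite (S_INR (S n)); set (m := INR (S n)) in *.
split.
- assert (h := ln_le_sub1 (m / (m + 1)) ltac:(apply Rdiv_lt_0_compat; lra)).
  rewrite ln_div in h by lra.
  replace (m / (m + 1) - 1) with (- / (m + 1)) in h by (field; lra); lra.
- assert (h := ln_le_sub1 ((m + 1) / m) ltac:(apply Rdiv_lt_0_compat; lra)).
  rewrite ln_div in h by lra.
  replace ((m + 1) / m - 1) with (/ m) in h by (field; lra); lra.
Qed.

Lemma inv_sqr_le_inv_gap (n : nat) : / INR (S n) * / INR (S n) <= 2 * inv_gap n.
Proof.
rewrite inv_gap_eq; assert (p := INR_S_ge1 n); rewrite (S_INR (S n)).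
set (m := INR (S n)) in *.
rewrite Rinv_mult.
assert (0 < / m) by (apply Rinv_0_lt_compat; lra).
replace (2 * (/ m * / (m + 1))) with (/ m * (2 * / (m + 1))) by ring.
apply Rmult_le_compat_l; [lra|].
apply Rmult_le_reg_r with (m * (m + 1)); [nra|]; field_simplify; lra.
Qed.

Lemma RtoC_neq0 (x : R) : x <> 0 -> RtoC x <> 0%C.
Proof. intros H E; apply H, RtoC_inj, E. Qed.

Lemma INR_S_neq0 (n : nat) : RtoC (INR (S n)) <> 0%C.
Proof. apply RtoC_neq0; generalize (INR_S_ge1 n); lra. Qed.

Lemma Cmod_div_INR (z : C) (n : nat) : Cmod (z / INR (S n)) = Cmod z * / INR (S n).
Proof.
rewrite Cmod_div, Cmod_R, Rabs_pos_eq by (apply INR_S_neq0 || (generalize (INR_S_ge1 n); lra)).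
reflexivity.
Qed.

Lemma Cmod_ge_half_neq0 (z : C) : 1 / 2 <= Cmod z -> z <> 0%C.
Proof. intros H; apply Cmod_gt_neq0; lra. Qed.

Lemma gauss_den_ge (n : nat) (z : C) : Cmod z <= 1 / 2 -> 1 / 2 <= Cmod (1 + z / INR (S n)).
Proof.
intros Hz; assert (h := Cmod_add_ge 1 (z / INR (S n))).
rewrite Cmod_1, Cmod_div_INR in h; assert (p := INR_S_ge1 n).
assert (/ INR (S n) <= 1) by (rewrite <- Rinv_1; apply Rinv_le_contravar; lra).
generalize (Cmod_ge_0 z); nra.
Qed.

Lemma gauss_factor_0 (n : nat) : gauss_factor n 0 = 1%C.
Proof.
unfold gauss_factor; rewrite Cmult_0_l, Cexp_0.
replace (1 + 0 / INR (S n))%C with (RtoC 1) by (unfold Cdiv; ring); field.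
Qed.

Lemma Cmod_div_le (x y : C) (a b : R) :
  Cmod x <= a -> 0 < b -> b <= Cmod y -> Cmod (x / y) <= a / b.
Proof.
intros Hx Hb Hy; rewrite Cmod_div by (apply Cmod_gt_neq0; lra).
apply Rmult_le_compat; [apply Cmod_ge_0| |exact Hx|].
- left; apply Rinv_0_lt_compat; lra.
- apply Rinv_le_contravar; lra.
Qed.

(** The exponent [z * dln n] and the denominator [1 + z / INR (S n)] agree to first order, so the
    dependence on [z] is of second order in [1 / (n + 1)], which is summable. *)
Lemma gauss_factor_lip (n : nat) (z w : C) : Cmod z <= 1 / 2 -> Cmod w <= 1 / 2 ->
  Cmod (gauss_factor n z - gauss_factor n w) <= 4000 * inv_gap n * Cmod (z - w).
Proof.
intros Hz Hw.
assert (pz := Cmod_ge_0 z); assert (pw := Cmod_ge_0 w).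
assert (Hd : Cmod (z - w) <= 1) by (generalize (Cmod_sub_le z w); lra).
assert (pd := Cmod_ge_0 (z - w)).
assert (Dz := gauss_den_ge n z Hz); assert (Dw := gauss_den_ge n w Hw).
assert (Nz := Cmod_ge_half_neq0 _ Dz).
assert (Nw := Cmod_ge_half_neq0 _ Dw).
destruct (dln_bounds n) as [l1 l2].
assert (m1 := INR_S_ge1 n); assert (sq := inv_sqr_le_inv_gap n); assert (dp := inv_gap_pos n).
assert (im : 0 < / INR (S n) <= 1).
{ split; [apply Rinv_0_lt_compat; lra|]; rewrite <- Rinv_1; apply Rinv_le_contravar; lra. }
assert (l0 : 0 < dln n).
{ eapply Rlt_le_trans; [|exact l1]; apply Rinv_0_lt_compat; generalize (INR_S_ge1 (S n)); lra. }
assert (ld : Rabs (dln n - / INR (S n)) <= inv_gap n) by (apply Rabs_le; unfold inv_gap; lra).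
unfold gauss_factor.
set (l := dln n) in *; set (i := / INR (S n)) in *.
assert (Ei : RtoC i = (/ INR (S n))%C) by (apply RtoC_inv; lra).
unfold Cdiv in Nz, Nw, Dz, Dw |- *; rewrite <- Ei in *.
set (d := (z - w)%C) in *.
(* Over the common denominator the numerator splits into three terms: the second-order remainder of
   the exponential, the gap between [l] and [i], and a product of two small quantities. Each is
   [inv_gap n] times [Cmod d], up to a constant. *)
assert (E : (Cexp (z * l) * / (1 + z * i) - Cexp (w * l) * / (1 + w * i) =
  Cexp (w * l) * ((Cexp (d * l) - 1 - d * l) + d * (l - i)%R + (w * i) * (Cexp (d * l) - 1))
   / ((1 + z * i) * (1 + w * i)))%C).
{ replace (z * l)%C with (w * l + d * l)%C by (unfold d; ring).
  rewrite Cexp_plus, RtoC_minus; unfold d; field; split; assumption. }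
rewrite E; clear E.
assert (cl : Cmod l = l) by (rewrite Cmod_R; apply Rabs_pos_eq; lra).
assert (ci : Cmod i = i) by (rewrite Cmod_R; apply Rabs_pos_eq; lra).
assert (ll : l * l <= 2 * inv_gap n) by nra.
assert (il : i * l <= 2 * inv_gap n) by nra.
assert (e1 : Cmod (Cexp (w * l)) <= 12).
{ assert (h := Cexp_taylor1 (w * l)); rewrite Cmod_mult, cl in h.
  specialize (h ltac:(nra)).
  assert (h' := Cmod_triangle (Cexp (w * l) - 1) 1).
  replace (Cexp (w * l) - 1 + 1)%C with (Cexp (w * l)) in h' by ring.
  rewrite Cmod_1 in h'; nra. }
set (D := Cmod d) in *.
assert (e2 : Cmod (Cexp (d * l) - 1 - d * l) <= 42 * inv_gap n * D).
{ assert (h := Cexp_taylor2 (d * l)); rewrite Cmod_mult, cl in h; fold D in h.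
  specialize (h ltac:(nra)).
  replace (21 * (D * l) ^ 2) with (21 * (l * l) * (D * D)) in h by ring.
  assert (D * D <= D) by nra.
  assert (21 * (l * l) * (D * D) <= 21 * (l * l) * D) by (apply Rmult_le_compat_l; nra).
  nra. }
assert (e3 : Cmod (d * (l - i)%R) <= inv_gap n * D).
{ rewrite Cmod_mult, Cmod_R; fold D; nra. }
assert (e4 : Cmod (w * i * (Cexp (d * l) - 1)) <= 22 * inv_gap n * D).
{ assert (h := Cexp_taylor1 (d * l)); rewrite Cmod_mult, cl in h; fold D in h.
  specialize (h ltac:(nra)).
  rewrite !Cmod_mult, ci.
  assert (Cmod w * i <= 1 / 2 * i) by nra.
  assert (h2 := Rmult_le_compat _ _ _ _ (Rmult_le_pos _ i pw (Rlt_le _ _ (proj1 im))) (Cmod_ge_0 _) H h).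
  eapply Rle_trans; [exact h2|].
  replace (1 / 2 * i * (22 * (D * l))) with (11 * D * (i * l)) by field.
  nra. }
(* The three terms add up to 65, the exponential in front is at most 12, and [12 * 65 <= 1000]; the
   two denominators of modulus at least 1/2 give the factor 4. *)
replace (4000 * inv_gap n * D) with (1000 * inv_gap n * D / (1 / 2 * (1 / 2))) by field.
apply Cmod_div_le; [|lra|rewrite Cmod_mult; apply Rmult_le_compat; lra].
rewrite Cmod_mult.
match goal with |- _ * Cmod (?a + ?b + ?c) <= _ =>
  assert (t1 := Cmod_triangle (a + b) c); assert (t2 := Cmod_triangle a b);
  set (X := Cmod (a + b + c)) in * end.
assert (X <= 65 * inv_gap n * D) by lra.
assert (pe := Cmod_ge_0 (Cexp (w * l))).
assert (0 <= inv_gap n * D) by nra.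
assert (0 <= X) by apply Cmod_ge_0.
nra.
Qed.

(** * From Gauss's product to Euler's limit, and the recurrence *)

Lemma Crising_neq0 (z : C) (n : nat) :
  (forall k, z + INR k <> 0)%C -> Crising z n <> 0%C.
Proof.
intros H; induction n as [|n IH]; simpl.
- apply RtoC_neq0; lra.
- apply Cmult_neq_0; auto.
Qed.

Lemma near1_neq0 (z : C) (k : nat) : Cmod z <= 1 / 2 -> (1 + z + INR k <> 0)%C.
Proof.
intros Hz; apply Cmod_gt_neq0.
assert (h := Cmod_add_ge (RtoC (1 + INR k)) z).
rewrite RtoC_plus, <- RtoC_plus, Cmod_R, Rabs_pos_eq in h by (generalize (pos_INR k); lra).
replace (1 + z + INR k)%C with (RtoC (1 + INR k) + z)%C by (rewrite RtoC_plus; ring).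
generalize (pos_INR k); lra.
Qed.

(** The exponents [dln] telescope to [ln (n + 1)], and the denominators multiply to the rising
    factorial of [1 + z] over [n!]. *)
Lemma gauss_prod_eq (n : nat) (z : C) : Cmod z <= 1 / 2 ->
  (Cprod gauss_factor n z * Crising (1 + z) n = INR (fact n) * Cexp (z * ln (INR (S n))))%C.
Proof.
intros Hz; induction n as [|n IH].
- simpl; rewrite ln_1; replace (z * 0)%C with (RtoC 0) by ring; rewrite Cexp_0; ring.
- cbn [Cprod Crising].
  transitivity ((Cprod gauss_factor n z * Crising (1 + z) n)
    * (gauss_factor n z * (1 + z + INR n)))%C; [ring|].
  rewrite IH; unfold gauss_factor.
  change (fact (S n)) with (S n * fact n)%nat.
  replace (z * ln (INR (S (S n))))%C with (z * ln (INR (S n)) + z * dln n)%C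
    by (unfold dln; rewrite RtoC_minus; ring).
  rewrite Cexp_plus, mult_INR, RtoC_mult.
  assert (h := near1_neq0 z n Hz).
  rewrite (S_INR n), RtoC_plus.
  assert (h1 := INR_S_neq0 n); rewrite S_INR, RtoC_plus in h1.
  field; split; [exact h1|].
  replace (INR n + 1 + z)%C with (1 + z + INR n)%C by ring; exact h.
Qed.

Lemma Ccv_over_n (c : C) : Ccv (fun n => c / INR (S n))%C 0.
Proof.
apply (Ccv_squeeze _ _ (fun n => Cmod c * / INR (S n)) 0).
- intros n _; replace (c / INR (S n) - 0)%C with (c / INR (S n))%C by ring.
  rewrite Cmod_div_INR; lra.
- replace (Finite 0) with (Finite (Cmod c * 0)) by (f_equal; ring).
  apply is_lim_seq_mult'; [apply is_lim_seq_const|apply inv_INR_S_lim].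
Qed.

Lemma Ccv_inv (u : nat -> C) (l : C) : l <> 0%C -> Ccv u l -> Ccv (fun n => / u n)%C (/ l).
Proof.
intros Hl H; assert (pl := proj1 (Cmod_gt_0 l) Hl).
assert (H' := proj2 (is_lim_seq_spec _ _) H).
assert (ev : exists N, forall n, (N <= n)%nat -> Cmod l / 2 <= Cmod (u n)).
{ apply is_lim_seq_spec in H; destruct (H (mkposreal (Cmod l / 2) ltac:(lra))) as [N HN].
  exists N; intros n Hn; specialize (HN n Hn); simpl in HN.
  rewrite Rminus_0_r, Rabs_pos_eq in HN by apply Cmod_ge_0.
  assert (h := Cmod_sub_ge l (l - u n)); rewrite (Cmod_sub_sym l (u n)) in h.
  replace (l - (l - u n))%C with (u n) in h by ring; lra. }
destruct ev as [N HN].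
apply (Ccv_squeeze _ _ (fun n => Cmod (u n - l) * (/ (Cmod l * (Cmod l / 2)))) N).
- intros n Hn; specialize (HN n Hn).
  assert (un : u n <> 0%C) by (apply Cmod_gt_neq0; lra).
  replace (/ u n - / l)%C with ((l - u n) / (l * u n))%C by (field; split; assumption).
  rewrite (Cmod_sub_sym (u n)).
  apply Cmod_div_le; [lra|nra|rewrite Cmod_mult; apply Rmult_le_compat; lra].
- replace (Finite 0) with (Finite (0 * (/ (Cmod l * (Cmod l / 2))))) by (f_equal; ring).
  apply is_lim_seq_mult'; [exact H|apply is_lim_seq_const].
Qed.

Lemma Ccv_incr (u : nat -> C) (l : C) : Ccv (fun n => u (S n)) l -> Ccv u l.
Proof. intros H; apply (is_lim_seq_incr_1 (fun n => Cmod (u n - l))); exact H. Qed.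

Lemma Ccv_incr' (u : nat -> C) (l : C) : Ccv u l -> Ccv (fun n => u (S n)) l.
Proof. intros H; apply (is_lim_seq_incr_1 (fun n => Cmod (u n - l))); exact H. Qed.

Lemma Gamma_seq_near1_cv (z g : C) : Cmod z <= 1 / 2 ->
  Ccv (fun n => Cprod gauss_factor n z) g -> Ccv (Gamma_seq (1 + z)) g.
Proof.
intros Hz Hg; apply Ccv_incr.
assert (K : Ccv (fun n => Cprod gauss_factor n z
    * / ((1 + z / INR (S n)) * (1 + (1 + z) / INR (S n))))%C (g * / ((1 + 0) * (1 + 0)))).
{ apply Ccv_mult; [exact Hg|]; apply Ccv_inv.
  - apply Cmult_neq_0; rewrite <- RtoC_plus; apply RtoC_neq0; lra.
  - apply Ccv_mult; (apply Ccv_plus; [apply Ccv_const|apply Ccv_over_n]). }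
replace (g * / ((1 + 0) * (1 + 0)))%C with g in K by field.
apply (Ccv_ext_ge _ _ _ 0) with (2 := K); intros n _.
unfold Gamma_seq; cbn [Crising].
assert (h := gauss_prod_eq n z Hz).
assert (hR := Crising_neq0 (1 + z) n (fun k => near1_neq0 z k Hz)).
assert (h1 := near1_neq0 z n Hz); assert (h2 := near1_neq0 z (S n) Hz).
assert (h3 := INR_S_neq0 n).
change (fact (S n)) with (S n * fact n)%nat; rewrite mult_INR, RtoC_mult.
replace ((1 + z) * ln (INR (S n)))%C with (ln (INR (S n)) + z * ln (INR (S n)))%C by ring.
rewrite Cexp_plus, Cexp_R, exp_ln by (generalize (INR_S_ge1 n); lra).
replace (Cprod gauss_factor n z) with
  (INR (fact n) * Cexp (z * ln (INR (S n))) / Crising (1 + z) n)%C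
  by (rewrite <- h; field; exact hR).
rewrite S_INR, RtoC_plus in h2, h3 |- *.
field; repeat split; try assumption.
Qed.

(** The recurrence already holds before the limit, up to the factor [1 / (1 + (z + 1) / N)] with
    [N = n + 1]. *)
Lemma Gamma_seq_succ (z : C) (n : nat) : (forall k, z + INR k <> 0)%C ->
  Gamma_seq (z + 1) (S n) = (Gamma_seq z (S n) * (z / (1 + (z + 1) / INR (S n))))%C.
Proof.
intros Hz; unfold Gamma_seq.
assert (Hs : forall m, (Crising (z + 1) m * z = Crising z (S m))%C).
{ induction m as [|m IH]; [simpl; ring|].
  change ((Crising (z + 1) m * (z + 1 + INR m)) * z = Crising z (S m) * (z + INR (S m)))%C.
  rewrite <- IH, S_INR, RtoC_plus; ring. }
assert (h0 := Hz 0%nat); simpl in h0; replace (z + 0)%C with z in h0 by ring.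
assert (Hz1 : forall k, (z + 1 + INR k <> 0)%C).
{ intros k; specialize (Hz (S k)); rewrite S_INR, RtoC_plus in Hz.
  replace (z + 1 + INR k)%C with (z + (INR k + 1))%C by ring; exact Hz. }
assert (c1 := Crising_neq0 (z + 1) (S n) Hz1).
rewrite <- (Hs (S n)).
change (Crising (z + 1) (S (S n))) with (Crising (z + 1) (S n) * (z + 1 + INR (S n)))%C.
replace ((z + 1) * ln (INR (S n)))%C with (ln (INR (S n)) + z * ln (INR (S n)))%C by ring.
rewrite Cexp_plus, Cexp_R, exp_ln by (generalize (INR_S_ge1 n); lra).
assert (h3 := INR_S_neq0 n); assert (h4 := Hz1 (S n)).
field; repeat split; try assumption.
replace (INR (S n) + (z + 1))%C with (z + 1 + INR (S n))%C by ring; exact h4.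
Qed.

Lemma shift_factor_cv (z : C) : Ccv (fun n => z / (1 + (z + 1) / INR (S n)))%C z.
Proof.
replace z with (z * / (1 + 0))%C at 1 by field.
unfold Cdiv at 1; apply Ccv_mult; [apply Ccv_const|apply Ccv_inv].
- apply Cmod_gt_neq0; rewrite <- RtoC_plus, Cmod_R, Rabs_pos_eq; lra.
- apply Ccv_plus; [apply Ccv_const|apply Ccv_over_n].
Qed.

Lemma Gamma_seq_cv_succ (z g : C) : (forall k, z + INR k <> 0)%C ->
  Ccv (Gamma_seq z) g -> Ccv (Gamma_seq (z + 1)) (z * g).
Proof.
intros Hz Hg; apply Ccv_incr.
rewrite Cmult_comm.
apply (Ccv_ext_ge (fun n => Gamma_seq z (S n) * (z / (1 + (z + 1) / INR (S n))))%C _ _ 0).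
- intros n _; symmetry; apply Gamma_seq_succ, Hz.
- apply Ccv_mult; [apply Ccv_incr', Hg|apply shift_factor_cv].
Qed.

Lemma Gamma_seq_cv_pred (z g : C) : (forall k, z + INR k <> 0)%C ->
  Ccv (Gamma_seq (z + 1)) g -> Ccv (Gamma_seq z) (g / z).
Proof.
intros Hz Hg; apply Ccv_incr.
assert (h0 := Hz 0%nat); simpl in h0; replace (z + 0)%C with z in h0 by ring.
apply (Ccv_ext_ge (fun n => Gamma_seq (z + 1) (S n) * / (z / (1 + (z + 1) / INR (S n))))%C _ _ 0).
- intros n _; rewrite (Gamma_seq_succ z n Hz).
  assert (h := Hz (S (S n))); rewrite S_INR, RtoC_plus in h.
  field; repeat split; try assumption; try apply INR_S_neq0.
  replace (INR (S n) + (z + 1))%C with (z + (INR (S n) + 1))%C by ring; exact h.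
- apply Ccv_mult; [apply Ccv_incr', Hg|apply Ccv_inv; [exact h0|apply shift_factor_cv]].
Qed.

(** * The reflection product and local bounds on Gamma at 1 *)

(** At [x = z ^ 2] these are the factors of Euler's product for [PI * z / sin (PI * z)]. Taking [x]
    as the variable turns a Lipschitz bound at 0 into an error quadratic in [z]. *)
Definition sine_factor (n : nat) (x : C) : C :=
  (/ (1 - x * (/ INR (S n) * / INR (S n))%R))%C.

Lemma sine_den_ge (n : nat) (x : C) :
  Cmod x <= 1 / 2 -> 1 / 2 <= Cmod (1 - x * (/ INR (S n) * / INR (S n))%R).
Proof.
intros Hx; assert (m1 := INR_S_ge1 n).
assert (im : 0 < / INR (S n) <= 1).
{ split; [apply Rinv_0_lt_compat; lra|]; rewrite <- Rinv_1; apply Rinv_le_contravar; lra. }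
set (i := / INR (S n)) in *.
assert (h := Cmod_sub_ge 1 (x * (i * i)%R)).
rewrite Cmod_1, Cmod_mult, Cmod_R, (Rabs_pos_eq (i * i)) in h by nra.
assert (i * i <= 1) by nra; generalize (Cmod_ge_0 x); nra.
Qed.

Lemma sine_factor_lip (n : nat) (x y : C) : Cmod x <= 1 / 2 -> Cmod y <= 1 / 2 ->
  Cmod (sine_factor n x - sine_factor n y) <= 4000 * inv_gap n * Cmod (x - y).
Proof.
intros Hx Hy; assert (dx := sine_den_ge n x Hx); assert (dy := sine_den_ge n y Hy).
assert (nx := Cmod_ge_half_neq0 _ dx).
assert (ny := Cmod_ge_half_neq0 _ dy).
assert (sq := inv_sqr_le_inv_gap n).
unfold sine_factor.
assert (0 <= / INR (S n) * / INR (S n)) by (apply Rle_0_sqr).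
set (i := / INR (S n) * / INR (S n)) in *.
replace (/ (1 - x * i) - / (1 - y * i))%C with
  ((x - y) * i / ((1 - x * i) * (1 - y * i)))%C by (field; split; assumption).
replace (4000 * inv_gap n * Cmod (x - y)) with
  (Cmod (x - y) * (1000 * inv_gap n) / (1 / 2 * (1 / 2))) by field.
assert (dp := inv_gap_pos n).
apply Cmod_div_le; [|lra|rewrite Cmod_mult; apply Rmult_le_compat; lra].
rewrite Cmod_mult, Cmod_R, Rabs_pos_eq by assumption.
apply Rmult_le_compat_l; [apply Cmod_ge_0|lra].
Qed.

(** Factor by factor, the exponentials at [z] and [- z] cancel and the denominators multiply to
    [1 - z ^ 2 / m ^ 2]. *)
Lemma gauss_prod_reflect (n : nat) (z : C) : Cmod z <= 1 / 2 ->
  (Cprod gauss_factor n z * Cprod gauss_factor n (- z) = Cprod sine_factor n (z * z))%C.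
Proof.
intros Hz; induction n as [|n IH]; [simpl; ring|].
cbn [Cprod]; rewrite <- IH.
transitivity (Cprod gauss_factor n z * Cprod gauss_factor n (- z)
  * (gauss_factor n z * gauss_factor n (- z)))%C; [ring|].
f_equal; unfold gauss_factor, sine_factor.
assert (E : (Cexp (z * dln n) * Cexp (- z * dln n) = 1)%C).
{ rewrite <- Cexp_plus, <- Cexp_0; f_equal; ring. }
assert (d1 := gauss_den_ge n z Hz).
assert (d2 := gauss_den_ge n (- z) ltac:(rewrite Cmod_opp; exact Hz)).
assert (n1 := Cmod_ge_half_neq0 _ d1).
assert (n2 := Cmod_ge_half_neq0 _ d2).
assert (m1 := INR_S_ge1 n).
unfold Cdiv in *; rewrite RtoC_mult; rewrite <- !RtoC_inv in * by lra.
set (i := / INR (S n)) in *.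
replace (1 - z * z * (i * i))%C with ((1 + z * i) * (1 + - z * i))%C by ring.
transitivity ((Cexp (z * dln n) * Cexp (- z * dln n)) / ((1 + z * i) * (1 + - z * i)))%C.
- field; split; [replace (1 - z * i)%C with (1 + - z * i)%C by ring|]; assumption.
- rewrite E; field; split; [replace (1 - z * i)%C with (1 + - z * i)%C by ring|]; assumption.
Qed.

Definition GammaS (z : C) : C := Gamma (1 + z).

(* The bound on GammaS z * GammaS (- z) replaces the Taylor expansion of GammaS at 0:
   the terms of first order cancel. *)
Lemma GammaS_local : exists L : R, 1 <= L /\
  GammaS 0 = 1%C /\
  (forall z, Cmod z <= 1 / 2 -> Ccv (Gamma_seq (1 + z)) (GammaS z)) /\
  (forall z w, Cmod z <= 1 / 2 -> Cmod w <= 1 / 2 ->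
     Cmod (GammaS z - GammaS w) <= L * Cmod (z - w)) /\
  (forall z, Cmod z <= 1 / 2 -> Cmod (GammaS z * GammaS (- z) - 1) <= L * Cmod z ^ 2).
Proof.
destruct (ex_Cprod_limit gauss_factor 4000 gauss_factor_0 gauss_factor_lip ltac:(lra))
  as [g [g0 [gc gl]]].
destruct (ex_Cprod_limit sine_factor 4000) as [q [q0 [qc ql]]].
{ intros n; unfold sine_factor; rewrite Cmult_0_l; field. }
{ apply sine_factor_lip. }
{ lra. }
assert (E : forall z, Cmod z <= 1 / 2 -> GammaS z = g z).
{ intros z Hz; apply CLim_seq_unique, Gamma_seq_near1_cv; auto. }
assert (h0 : Cmod 0 <= 1 / 2) by (rewrite Cmod_0; lra).
exists (exp 4000 * 4000); split; [|split; [|split; [|split]]].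
- assert (h := exp_ineq1_le 4000); lra.
- rewrite E; assumption.
- intros z Hz; rewrite E by exact Hz; apply Gamma_seq_near1_cv; auto.
- intros z w Hz Hw; rewrite !E by assumption; auto.
- intros z Hz.
  assert (Hm : Cmod (- z) <= 1 / 2) by (rewrite Cmod_opp; exact Hz).
  assert (Hzz : Cmod (z * z) <= 1 / 2) by (rewrite Cmod_mult; generalize (Cmod_ge_0 z); nra).
  rewrite !E by assumption.
  replace (g z * g (- z))%C with (q (z * z))%C.
  + assert (h := ql (z * z)%C 0%C Hzz h0); rewrite q0 in h.
    replace (z * z - 0)%C with (z * z)%C in h by ring.
    rewrite Cmod_mult in h; simpl; rewrite Rmult_1_r; exact h.
  + apply (Ccv_unique (fun n => Cprod sine_factor n (z * z))); [apply qc, Hzz|].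
    apply (Ccv_ext_ge (fun n => Cprod gauss_factor n z * Cprod gauss_factor n (- z))%C _ _ 0).
    * intros n _; apply gauss_prod_reflect, Hz.
    * apply Ccv_mult; auto.
Qed.

(** * Fixed points and the Newton map with constant slope *)

Lemma contraction_fixed_point (f : C -> C) (c : C) (r : R) :
  (forall x y, Cmod (x - c) <= r -> Cmod (y - c) <= r ->
     Cmod (f x - f y) <= 1 / 2 * Cmod (x - y)) ->
  Cmod (f c - c) <= r / 2 ->
  exists x, f x = x /\ Cmod (x - c) <= 2 * Cmod (f c - c).
Proof.
intros Hf Hc.
assert (e0 := Cmod_ge_0 (f c - c)); set (e := Cmod (f c - c)) in *.
set (u := fun n => Nat.iter n f c).
assert (us : forall n, u (S n) = f (u n)) by reflexivity.
assert (u0 : u 0%nat = c) by reflexivity.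
clearbody u.
assert (p : forall n, 0 < (1 / 2) ^ n) by (intros n; apply pow_lt; lra).
(* Position and step size are carried together: the geometric sum keeps the iterates within
   [2 * e <= r] of [c], where the contraction hypothesis applies to the next step. *)
assert (H : forall n, Cmod (u n - c) <= 2 * e * (1 - (1 / 2) ^ n) /\
   Cmod (u (S n) - u n) <= e * (1 / 2) ^ n).
{ induction n as [|n [IH1 IH2]].
  - rewrite us, u0; fold e; replace (c - c)%C with (RtoC 0) by ring; rewrite Cmod_0; simpl; lra.
  - assert (B1 : Cmod (u (S n) - c) <= 2 * e * (1 - (1 / 2) ^ S n)).
    { replace (u (S n) - c)%C with ((u (S n) - u n) + (u n - c))%C by ring.
      eapply Rle_trans; [apply Cmod_triangle|]; simpl; lra. }
    split; [exact B1|].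
    assert (K : Cmod (f (u (S n)) - f (u n)) <= 1 / 2 * Cmod (u (S n) - u n)).
    { apply Hf; [specialize (p (S n))|specialize (p n)]; nra. }
    rewrite <- !us in K; simpl; lra. }
assert (T : is_lim_seq (fun n => 2 * e * (1 / 2) ^ n) 0).
{ replace (Finite 0) with (Finite (2 * e * 0)) by (f_equal; ring).
  apply is_lim_seq_mult'; [apply is_lim_seq_const|].
  apply is_lim_seq_geom; rewrite Rabs_pos_eq; lra. }
destruct (ex_Ccv_telescope u (fun n => 2 * e * (1 / 2) ^ n)) as [x [Hx Hb]].
- intros n; destruct (H n) as [_ h]; simpl; lra.
- exact T.
- simpl in Hb; rewrite u0, Rmult_1_r in Hb; exists x; split; [|exact Hb].
  apply (Ccv_unique (fun n => u (S n))); [|apply Ccv_incr', Hx].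
  apply (Ccv_squeeze _ _ (fun n => 1 / 2 * Cmod (u n - x)) 0).
  + intros n _; rewrite us; apply Hf; [|lra].
    destruct (H n) as [h _]; specialize (p n); nra.
  + replace (Finite 0) with (Finite (1 / 2 * 0)) by (f_equal; ring).
    apply is_lim_seq_mult'; [apply is_lim_seq_const|exact Hx].
Qed.

(** The map [x - f x / d] contracts by 1/2 as soon as [f] minus the linear map of slope [d] has
    Lipschitz constant at most half of [Cmod d]; no derivative of [f] appears. *)
Lemma newton_root (f : C -> C) (c d : C) (r : R) : d <> 0%C ->
  (forall x y, Cmod (x - c) <= r -> Cmod (y - c) <= r ->
     Cmod (f x - f y - d * (x - y)) <= Cmod d / 2 * Cmod (x - y)) ->
  Cmod (f c) <= Cmod d * (r / 2) ->
  exists x, f x = 0%C /\ Cmod (x - c) <= 2 * (Cmod (f c) / Cmod d).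
Proof.
intros Hd Hf Hc; assert (pd := proj1 (Cmod_gt_0 d) Hd).
assert (E : Cmod (c - f c / d - c) = Cmod (f c) / Cmod d).
{ rewrite <- Cmod_div by exact Hd; rewrite <- Cmod_opp; f_equal; ring. }
destruct (contraction_fixed_point (fun x => x - f x / d)%C c r) as [x [Hx Hb]].
- intros x y Hx Hy.
  replace (x - f x / d - (y - f y / d))%C with (- ((f x - f y - d * (x - y)) / d))%C
    by (field; exact Hd).
  rewrite Cmod_opp, Cmod_div by exact Hd.
  apply Rmult_le_reg_r with (Cmod d); [exact pd|].
  unfold Rdiv at 1; rewrite Rmult_assoc, Rinv_l by lra.
  specialize (Hf x y Hx Hy); lra.
- rewrite E; apply Rmult_le_reg_r with (Cmod d); [exact pd|].
  unfold Rdiv at 1; rewrite Rmult_assoc, Rinv_l by lra; lra.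
- exists x; split; [|rewrite <- E; exact Hb].
  replace (f x) with ((x - (x - f x / d)) * d)%C by (field; exact Hd).
  rewrite Hx; ring.
Qed.

(** * The normalised sine, the rescaled quadratic and the Gamma quotient *)

(** Scaled to have slope 1 at 0, so that it is a perturbation of the identity. *)
Definition sinpi (x : C) : C := (Csin (PI * x) / PI)%C.

Lemma PI_bounds : 3 < PI <= 4.
Proof. split; [generalize PI2_3_2; lra | apply PI_4]. Qed.

Lemma PI_C_neq0 : RtoC PI <> 0%C.
Proof. apply RtoC_neq0, PI_neq0. Qed.

Lemma Cmod_PI_mult (x : C) : Cmod (PI * x) = PI * Cmod x.
Proof. rewrite Cmod_mult, Cmod_R, Rabs_pos_eq by (generalize PI_bounds; lra); reflexivity. Qed.

Lemma Cmod_div_PI (x : C) : Cmod (x / PI) = Cmod x / PI.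
Proof.
rewrite Cmod_div, Cmod_R, Rabs_pos_eq by (apply PI_C_neq0 || (generalize PI_bounds; lra)).
reflexivity.
Qed.

Lemma sinpi_near_identity (x y : C) : Cmod x <= 1 / 8 -> Cmod y <= 1 / 8 ->
  Cmod (sinpi x - sinpi y - (x - y)) <= 2400 * (Cmod x + Cmod y) * Cmod (x - y).
Proof.
intros Hx Hy; destruct PI_bounds as [P1 P2].
assert (px := Cmod_ge_0 x); assert (py := Cmod_ge_0 y); assert (pd := Cmod_ge_0 (x - y)).
assert (h := Csin_near_identity (PI * x) (PI * y)).
replace (PI * x - PI * y)%C with (PI * (x - y))%C in h by ring.
rewrite !Cmod_PI_mult in h.
specialize (h ltac:(nra) ltac:(nra)).
replace (sinpi x - sinpi y - (x - y))%C with
  ((Csin (PI * x) - Csin (PI * y) - PI * (x - y)) / PI)%C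
  by (unfold sinpi; field; apply PI_C_neq0).
rewrite Cmod_div_PI; apply Rmult_le_reg_r with PI; [lra|].
unfold Rdiv; rewrite Rmult_assoc, Rinv_l, Rmult_1_r by lra.
eapply Rle_trans; [exact h|].
replace (600 * (PI * Cmod x + PI * Cmod y) * (PI * Cmod (x - y))) with
  (600 * PI * ((Cmod x + Cmod y) * Cmod (x - y)) * PI) by ring.
apply Rmult_le_compat_r; [lra|].
assert (0 <= (Cmod x + Cmod y) * Cmod (x - y)) by (apply Rmult_le_pos; lra).
nra.
Qed.

Lemma sinpi_cubic (x : C) : Cmod x <= 1 / 8 -> Cmod (sinpi x - x) <= 320 * Cmod x ^ 3.
Proof.
intros Hx; destruct PI_bounds as [P1 P2]; assert (px := Cmod_ge_0 x).
assert (h := Csin_cubic (PI * x)); rewrite Cmod_PI_mult in h; specialize (h ltac:(nra)).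
replace (sinpi x - x)%C with ((Csin (PI * x) - PI * x) / PI)%C
  by (unfold sinpi; field; apply PI_C_neq0).
rewrite Cmod_div_PI; apply Rmult_le_reg_r with PI; [lra|].
unfold Rdiv; rewrite Rmult_assoc, Rinv_l, Rmult_1_r by lra.
eapply Rle_trans; [exact h|].
replace (20 * (PI * Cmod x) ^ 3) with (20 * (PI * PI) * Cmod x ^ 3 * PI) by ring.
apply Rmult_le_compat_r; [lra|].
assert (0 <= Cmod x ^ 3) by (apply pow_le, px).
apply Rmult_le_compat_r; nra.
Qed.

Lemma sinpi_0 : sinpi 0 = 0%C.
Proof. unfold sinpi; rewrite Cmult_0_r, Csin_0; unfold Cdiv; ring. Qed.

Lemma Cmod_pos (x : R) : 0 <= x -> Cmod x = x.
Proof. intros H; rewrite Cmod_R; apply Rabs_pos_eq, H. Qed.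

(* After rescaling, both equations are lam-perturbations of the quadratic
   (a + u) u + k = 0, whose derivative at the approximate root c is a + 2 c. *)
Lemma scaled_root (M : R) : 0 <= M -> exists Lam : R, 0 < Lam /\
  forall (lam : R) (a c : C) (k : C -> C), 0 < lam <= Lam ->
  Cmod a <= 1 -> Cmod c <= 2 -> 1 <= Cmod (a + 2 * c) ->
  (forall x y, Cmod x <= 3 -> Cmod y <= 3 ->
     Cmod (k x - k y) <= M * lam * Cmod (x - y)) ->
  let f u := ((a + u) * (sinpi (lam * u) / lam) + k u)%C in
  Cmod (f c) <= 1 / 16 ->
  exists u, f u = 0%C /\ Cmod (u - c) <= 2 * Cmod (f c).
Proof.
(* The terms that carry [lam] have total Lipschitz constant at most [(4 * 14400 + 43200 + M) * lam],
   which this choice keeps below 1/4. *)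
intros HM; exists (/ (4 * (110000 + M))); split; [apply Rinv_0_lt_compat; lra|].
intros lam a c k [Hl0 Hl] Ha Hc Hd Hk f Hf.
assert (HL : lam * (110000 + M) <= 1 / 4).
{ apply (Rmult_le_compat_r (110000 + M)) in Hl; [|lra].
  eapply Rle_trans; [exact Hl|right; field; lra]. }
assert (Hls : lam <= 1 / 440000) by nra.
assert (Cl : Cmod lam = lam) by (apply Cmod_pos; lra).
assert (Nl : RtoC lam <> 0%C) by (apply RtoC_neq0; lra).
set (g := fun u : C => (sinpi (lam * u) / lam)%C).
assert (Hg : forall x y, Cmod x <= 3 -> Cmod y <= 3 ->
  Cmod (g x - g y - (x - y)) <= 14400 * lam * Cmod (x - y)).
{ intros x y Hx Hy.
  assert (px := Cmod_ge_0 x); assert (py := Cmod_ge_0 y); assert (pd := Cmod_ge_0 (x - y)).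
  assert (h := sinpi_near_identity (lam * x) (lam * y)).
  replace (lam * x - lam * y)%C with (lam * (x - y))%C in h by ring.
  rewrite !Cmod_mult, Cl in h.
  specialize (h ltac:(nra) ltac:(nra)).
  replace (g x - g y - (x - y))%C with
    ((sinpi (lam * x) - sinpi (lam * y) - lam * (x - y)) / lam)%C
    by (unfold g; field; exact Nl).
  rewrite Cmod_div, Cl by exact Nl; apply Rmult_le_reg_r with lam; [lra|].
  unfold Rdiv; rewrite Rmult_assoc, Rinv_l, Rmult_1_r by lra.
  eapply Rle_trans; [exact h|].
  replace (2400 * (lam * Cmod x + lam * Cmod y) * (lam * Cmod (x - y))) with
    (2400 * lam * Cmod (x - y) * lam * (Cmod x + Cmod y)) by ring.
  replace (14400 * lam * Cmod (x - y) * lam) with (2400 * lam * Cmod (x - y) * lam * 6) by ring.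
  apply Rmult_le_compat_l; [|lra].
  repeat apply Rmult_le_pos; lra. }
assert (g0 : g 0%C = 0%C) by (unfold g; rewrite Cmult_0_r, sinpi_0; unfold Cdiv; ring).
assert (Nd : (a + 2 * c)%C <> 0%C) by (apply Cmod_gt_neq0; lra).
(* Radius 1/8 bounds the curvature term [(x - c) + (y - c)] by 1/4; with the 1/4 from the [lam]
   terms this makes 1/2, at most half the slope. It also matches the residual bound 1/16. *)
destruct (newton_root f c (a + 2 * c) (1 / 8) Nd) as [u [Hu1 Hu2]].
- intros x y Hx Hy.
  assert (B : forall x, Cmod (x - c) <= 1 / 8 -> Cmod x <= 3).
  { intros z Hz; assert (h := Cmod_triangle (z - c) c).
    replace (z - c + c)%C with z in h by ring; lra. }
  assert (Bx := B x Hx); assert (By := B y Hy).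
  assert (pd := Cmod_ge_0 (x - y)).
  assert (py := Cmod_ge_0 y).
  assert (h1 := Hg x y Bx By).
  assert (h2 := Hg y 0%C By ltac:(rewrite Cmod_0; lra)); rewrite g0 in h2.
  replace (g y - 0 - (y - 0))%C with (g y - y)%C in h2 by ring.
  replace (y - 0)%C with y in h2 by ring.
  assert (h3 := Hk x y Bx By).
  replace (f x - f y - (a + 2 * c) * (x - y))%C with
   ((a + x) * (g x - g y - (x - y)) + (x - y) * (g y - y)
    + (x - y) * ((x - c) + (y - c)) + (k x - k y))%C by (unfold f, g; ring).
  assert (b1 : Cmod ((a + x) * (g x - g y - (x - y))) <= 4 * (14400 * lam * Cmod (x - y))).
  { rewrite Cmod_mult; apply Rmult_le_compat; try apply Cmod_ge_0; [|exact h1].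
    generalize (Cmod_triangle a x); lra. }
  assert (b2 : Cmod ((x - y) * (g y - y)) <= Cmod (x - y) * (43200 * lam)).
  { rewrite Cmod_mult; apply Rmult_le_compat_l; [exact pd|].
    eapply Rle_trans; [exact h2|]; nra. }
  assert (b3 : Cmod ((x - y) * ((x - c) + (y - c))) <= Cmod (x - y) * (1 / 4)).
  { rewrite Cmod_mult; apply Rmult_le_compat_l; [exact pd|].
    generalize (Cmod_triangle (x - c) (y - c)); lra. }
  eapply Rle_trans; [apply Cmod_triangle|].
  eapply Rle_trans; [apply Rplus_le_compat_r, Cmod_triangle|].
  eapply Rle_trans; [apply Rplus_le_compat_r, Rplus_le_compat_r, Cmod_triangle|].
  set (D := Cmod (x - y)) in *.
  assert (1 / 2 * D <= Cmod (a + 2 * c) / 2 * D) by nra.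
  assert (D * (lam * (110000 + M)) <= D * (1 / 4)) by (apply Rmult_le_compat_l; lra).
  nra.
- nra.
- exists u; split; [exact Hu1|].
  eapply Rle_trans; [exact Hu2|].
  apply Rmult_le_compat_l; [lra|].
  apply Rmult_le_reg_r with (Cmod (a + 2 * c)); [lra|].
  unfold Rdiv; rewrite Rmult_assoc, Rinv_l, Rmult_1_r by lra.
  generalize (Cmod_ge_0 (f c)); nra.
Qed.

(* beta = sigma - x turns Gamma (2 sigma + 1 - beta) Gamma (beta + 1) / Gamma (2 sigma + 1)
   into this quotient, symmetric in x. *)
Definition gamma_quot (sigma : R) (x : C) : C :=
  (GammaS (sigma + x) * GammaS (sigma - x) / GammaS (2 * sigma))%C.

(** For the last bound, [sigma] is removed from each Gamma factor at a cost of order [Rabs sigma].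
    What remains is [GammaS x * GammaS (- x)], whose distance from 1 is quadratic in [x]. *)
Lemma gamma_quot_local : exists M rho : R, 1 <= M /\ 0 < rho <= 1 / 8 /\
  forall sigma, Rabs sigma <= rho ->
    GammaS (2 * sigma) <> 0%C /\
    (forall x, Cmod x <= rho -> Cmod (gamma_quot sigma x) <= M) /\
    (forall x y, Cmod x <= rho -> Cmod y <= rho ->
       Cmod (gamma_quot sigma x - gamma_quot sigma y) <= M * Cmod (x - y)) /\
    (forall x, Cmod x <= rho ->
       Cmod (gamma_quot sigma x - 1) <= M * (Rabs sigma + Cmod x ^ 2)).
Proof.
destruct GammaS_local as [L [L1 [G0 [_ [GL GR]]]]].
(* This [rho] keeps [GammaS (2 * sigma)] within 1/4 of 1, so the denominator is at least 1/2.
   Numerators are bounded with [6 * L ^ 2], and the denominator doubles that. *)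
exists (12 * L ^ 2), (/ (8 * L)); split; [nra|].
assert (Hr : 0 < / (8 * L)) by (apply Rinv_0_lt_compat; lra).
assert (HrL : / (8 * L) * L = 1 / 8) by (field; lra).
set (rho := / (8 * L)) in *.
assert (Hr8 : rho <= 1 / 8) by nra.
split; [split; assumption|].
intros sg Hs; assert (ps := Rabs_pos sg).
assert (Cs : Cmod sg = Rabs sg) by apply Cmod_R.
assert (C2s : Cmod (2 * sg) = 2 * Rabs sg) by (rewrite Cmod_mult, Cs, Cmod_pos; lra).
assert (z0 : Cmod 0 <= 1 / 2) by (rewrite Cmod_0; lra).
assert (G2 : Cmod (GammaS (2 * sg) - 1) <= 2 * L * Rabs sg).
{ rewrite <- G0; eapply Rle_trans; [apply GL; lra|].
  replace (2 * sg - 0)%C with (2 * sg)%C by ring; rewrite C2s; lra. }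
assert (G2h : 1 / 2 <= Cmod (GammaS (2 * sg))).
{ assert (h := Cmod_sub_ge 1 (1 - GammaS (2 * sg))).
  replace (1 - (1 - GammaS (2 * sg)))%C with (GammaS (2 * sg)) in h by ring.
  rewrite Cmod_1, (Cmod_sub_sym 1) in h; nra. }
assert (N2 := Cmod_ge_half_neq0 _ G2h).
assert (GB : forall z, Cmod z <= 1 / 2 -> Cmod (GammaS z) <= 2 * L).
{ intros z Hz; assert (h := GL z 0%C Hz z0); rewrite G0 in h.
  replace (z - 0)%C with z in h by ring.
  assert (h' := Cmod_triangle (GammaS z - 1) 1); replace (GammaS z - 1 + 1)%C with (GammaS z) in h' by ring.
  rewrite Cmod_1 in h'; nra. }
assert (Ip : forall x, Cmod x <= rho -> Cmod (sg + x) <= 1 / 2)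
  by (intros x Hx; generalize (Cmod_triangle sg x); lra).
assert (Im : forall x, Cmod x <= rho -> Cmod (sg - x) <= 1 / 2)
  by (intros x Hx; generalize (Cmod_sub_le sg x); lra).
split; [exact N2|]; split; [|split].
- intros x Hx; unfold gamma_quot.
  replace (12 * L ^ 2) with (6 * L ^ 2 / (1 / 2)) by field.
  apply Cmod_div_le; [|lra|exact G2h].
  rewrite Cmod_mult.
  assert (h := Rmult_le_compat _ _ _ _ (Cmod_ge_0 _) (Cmod_ge_0 _) (GB _ (Ip x Hx)) (GB _ (Im x Hx))).
  nra.
- intros x y Hx Hy; unfold gamma_quot.
  match goal with |- Cmod ?t <= _ => replace t with
   (((GammaS (sg + x) - GammaS (sg + y)) * GammaS (sg - x)
     + GammaS (sg + y) * (GammaS (sg - x) - GammaS (sg - y))) / GammaS (2 * sg))%C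
    by (field; exact N2) end.
  replace (12 * L ^ 2 * Cmod (x - y)) with (6 * L ^ 2 * Cmod (x - y) / (1 / 2)) by field.
  apply Cmod_div_le; [|lra|exact G2h].
  eapply Rle_trans; [apply Cmod_triangle|]; rewrite !Cmod_mult.
  assert (a1 := GL _ _ (Ip x Hx) (Ip y Hy)); assert (a2 := GL _ _ (Im x Hx) (Im y Hy)).
  replace (sg + x - (sg + y))%C with (x - y)%C in a1 by ring.
  replace (sg - x - (sg - y))%C with (- (x - y))%C in a2 by ring; rewrite Cmod_opp in a2.
  assert (h1 := Rmult_le_compat _ _ _ _ (Cmod_ge_0 _) (Cmod_ge_0 _) a1 (GB _ (Im x Hx))).
  assert (h2 := Rmult_le_compat _ _ _ _ (Cmod_ge_0 _) (Cmod_ge_0 _) (GB _ (Ip y Hy)) a2).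
  assert (0 <= L ^ 2 * Cmod (x - y)) by (apply Rmult_le_pos; [nra|apply Cmod_ge_0]).
  nra.
- intros x Hx; unfold gamma_quot.
  assert (hx : Cmod x <= 1 / 2) by lra.
  assert (hmx : Cmod (- x) <= 1 / 2) by (rewrite Cmod_opp; lra).
  match goal with |- Cmod ?t <= _ => replace t with
   (((GammaS (sg + x) - GammaS x) * GammaS (sg - x)
     + GammaS x * (GammaS (sg - x) - GammaS (- x))
     + (GammaS x * GammaS (- x) - 1) + (1 - GammaS (2 * sg))) / GammaS (2 * sg))%C
    by (field; exact N2) end.
  replace (12 * L ^ 2 * (Rabs sg + Cmod x ^ 2)) with
    (6 * L ^ 2 * (Rabs sg + Cmod x ^ 2) / (1 / 2)) by field.
  apply Cmod_div_le; [|lra|exact G2h].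
  eapply Rle_trans; [apply Cmod_triangle|].
  eapply Rle_trans; [apply Rplus_le_compat_r, Cmod_triangle|].
  eapply Rle_trans; [apply Rplus_le_compat_r, Rplus_le_compat_r, Cmod_triangle|].
  rewrite (Cmod_mult (_ - _)), (Cmod_mult _ (_ - _)), (Cmod_sub_sym 1).
  assert (a1 := GL _ _ (Ip x Hx) hx); assert (a2 := GL _ _ (Im x Hx) hmx).
  replace (sg + x - x)%C with (RtoC sg) in a1 by ring; rewrite Cs in a1.
  replace (sg - x - - x)%C with (RtoC sg) in a2 by ring; rewrite Cs in a2.
  assert (h1 := Rmult_le_compat _ _ _ _ (Cmod_ge_0 _) (Cmod_ge_0 _) a1 (GB _ (Im x Hx))).
  assert (h2 := Rmult_le_compat _ _ _ _ (Cmod_ge_0 _) (Cmod_ge_0 _) (GB _ hx) a2).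
  assert (h3 := GR x hx).
  assert (px := pow2_ge_0 (Cmod x)).
  assert (L <= L ^ 2) by nra.
  assert (L * Cmod x ^ 2 <= L ^ 2 * Cmod x ^ 2) by (apply Rmult_le_compat_r; lra).
  assert (L * Rabs sg <= L ^ 2 * Rabs sg) by (apply Rmult_le_compat_r; lra).
  nra.
Qed.

(** * Gamma near 0, 2 and 3, and [F] in local coordinates *)

Lemma Gamma_seq_cv_GammaS (z : C) : Cmod z <= 1 / 2 -> Ccv (Gamma_seq (1 + z)) (GammaS z).
Proof. destruct GammaS_local as [L [_ [_ [H _]]]]; apply H. Qed.

Lemma Gamma_seq_cv_near2 (z : C) : Cmod z <= 1 / 2 ->
  Ccv (Gamma_seq (2 + z)) ((1 + z) * GammaS z).
Proof.
intros Hz; replace (2 + z)%C with (1 + z + 1)%C by ring.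
apply Gamma_seq_cv_succ; [|apply Gamma_seq_cv_GammaS, Hz].
intros k; apply near1_neq0, Hz.
Qed.

Lemma Gamma_near2 (z : C) : Cmod z <= 1 / 2 -> Gamma (2 + z) = ((1 + z) * GammaS z)%C.
Proof. intros Hz; apply CLim_seq_unique, Gamma_seq_cv_near2, Hz. Qed.

Lemma Gamma_near3 (z : C) : Cmod z <= 1 / 2 ->
  Gamma (3 + z) = ((2 + z) * ((1 + z) * GammaS z))%C.
Proof.
intros Hz; replace (3 + z)%C with (2 + z + 1)%C by ring.
apply CLim_seq_unique, Gamma_seq_cv_succ; [|apply Gamma_seq_cv_near2, Hz].
intros k; assert (h := near1_neq0 z (S k) Hz); rewrite S_INR, RtoC_plus in h.
replace (2 + z + INR k)%C with (1 + z + (INR k + 1))%C by ring; exact h.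
Qed.

Lemma Gamma_near0 (x : R) : 0 < x <= 1 / 2 -> Gamma x = (GammaS x / x)%C.
Proof.
intros Hx; apply CLim_seq_unique, Gamma_seq_cv_pred.
- intros k; rewrite <- RtoC_plus; apply RtoC_neq0; generalize (pos_INR k); lra.
- replace (x + 1)%C with (1 + x)%C by ring; apply Gamma_seq_cv_GammaS.
  rewrite Cmod_pos; lra.
Qed.

Lemma not_Gamma_pole (z : C) : 0 < Re z -> ~ Gamma_pole z.
Proof.
intros H [k E]; rewrite E, <- RtoC_opp in H; simpl in H; generalize (pos_INR k); lra.
Qed.

(** The two Gamma arguments become [1 - z] and [2 * s + 1 + z], both with positive real part. *)
Lemma F_defined_near (s : R) (beta z : C) :
  Cmod z < 1 / 2 -> beta = (2 * s + z)%C -> 0 <= s -> F_defined s beta.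
Proof.
intros Hz E Hs; rewrite E; assert (h := re_le_Cmod z).
assert (h' : Rabs (Re z) < 1 / 2) by lra; apply Rabs_def2 in h'.
destruct z as [a b]; simpl in h'.
split; apply not_Gamma_pole; simpl; lra.
Qed.

Lemma Csin_PI_sinpi (x : C) : Csin (PI * x) = (PI * sinpi x)%C.
Proof. unfold sinpi; field; apply PI_C_neq0. Qed.

Lemma sinpi_opp (x : C) : sinpi (- x) = (- sinpi x)%C.
Proof.
unfold sinpi; replace (PI * - x)%C with (- (PI * x))%C by ring.
rewrite Csin_opp; unfold Cdiv; ring.
Qed.

Lemma sinpi_add1 (x : C) : sinpi (x + 1) = (- sinpi x)%C.
Proof.
unfold sinpi; replace (PI * (x + 1))%C with (PI * x + PI)%C by ring.
rewrite Csin_plus_pi; unfold Cdiv; ring.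
Qed.

(** The pole gives [1 / Gamma (2 * s) = 2 * s / GammaS (2 * s)]; this factor [2 * s] makes both
    terms quadratic in [(s, x)]. *)
Lemma F_near_0 (s : R) (x : C) : 0 < s <= 1 / 4 -> Cmod x <= 1 / 4 ->
  GammaS (2 * s) <> 0%C ->
  F s (s - x) = (PI * ((s + x) * sinpi x - 2 * s * sinpi s * gamma_quot s x))%C.
Proof.
intros Hs Hx HG; unfold F.
replace (s - (s - x))%C with x by ring.
replace (2 * s + 1 - (s - x))%C with (1 + (s + x))%C by ring.
replace (s - x + 1)%C with (1 + (s - x))%C by ring.
rewrite !Csin_PI_sinpi, <- RtoC_mult, (Gamma_near0 (2 * s)) by lra.
rewrite RtoC_mult.
change (Gamma (1 + (s + x))) with (GammaS (s + x)).
change (Gamma (1 + (s - x))) with (GammaS (s - x)).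
unfold gamma_quot; field.
split; [exact HG|apply RtoC_neq0; lra].
Qed.

(** The rational factor that the recurrence extracts from [Gamma (3 + (x - e)) / Gamma (2 - 2 * e)].
    It equals [2 + 3 * x] up to terms of order [e] and [x ^ 2]. *)
Definition cubic_factor (e : R) (x : C) : C :=
  ((1 + (x - e)) * (2 + (x - e)) / (1 - 2 * e))%C.

(** Here [gamma_quot] is taken at [sigma = s - 1 = - e]. Since [Gamma (2 * s)] is regular near 2,
    the second term is only linear in [e], against a first term quadratic in [(e, x)]. *)
Lemma F_near_1 (e : R) (x : C) : 0 <= e <= 1 / 4 -> Cmod x <= 1 / 4 ->
  GammaS (2 * (- e)%R) <> 0%C ->
  F (1 - e) (2 - e + x) = (- (PI * ((e + x) * sinpi x + sinpi e *
    (cubic_factor e x * gamma_quot (- e) x))))%C.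
Proof.
intros He Hx HG.
assert (Ce : Cmod e = e) by (apply Cmod_pos; lra).
unfold F; rewrite RtoC_minus.
replace (2 * (1 - e) - (2 - e + x))%C with (- (e + x))%C by ring.
replace (1 - e - (2 - e + x))%C with (- (x + 1))%C by ring.
replace (2 * (1 - e) + 1 - (2 - e + x))%C with (1 + ((- e)%R - x))%C by (rewrite RtoC_opp; ring).
replace (2 - e + x + 1)%C with (3 + (x - e))%C by ring.
replace (2 * (1 - e))%C with (2 + 2 * (- e)%R)%C by (rewrite RtoC_opp; ring).
rewrite Gamma_near2, Gamma_near3.
- rewrite !Csin_PI_sinpi.
  replace (1 - e)%C with (- e + 1)%C by ring.
  rewrite sinpi_opp, !sinpi_add1, sinpi_opp.
  change (Gamma (1 + ((- e)%R - x))) with (GammaS ((- e)%R - x)).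
  unfold gamma_quot, cubic_factor.
  replace ((- e)%R + x)%C with (x - e)%C by (rewrite RtoC_opp; ring).
  replace (1 + 2 * (- e)%R)%C with (1 - 2 * e)%C by (rewrite RtoC_opp; ring).
  assert (N : (1 - 2 * e)%C <> 0%C)
    by (rewrite <- RtoC_mult, <- RtoC_minus; apply RtoC_neq0; lra).
  field; split; assumption.
- generalize (Cmod_sub_le x e); lra.
- rewrite <- RtoC_mult, Cmod_R; apply Rabs_le; lra.
Qed.

Lemma sinpi_ratio (e : R) : 0 < e <= 1 / 40 ->
  Cmod (sinpi e / e - 1) <= 320 * e ^ 2 /\ Cmod (sinpi e / e) <= 2.
Proof.
intros He; assert (Ce : Cmod e = e) by (apply Cmod_pos; lra).
assert (Ne : RtoC e <> 0%C) by (apply RtoC_neq0; lra).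
assert (h := sinpi_cubic e ltac:(lra)); rewrite Ce in h.
assert (B : Cmod (sinpi e / e - 1) <= 320 * e ^ 2).
{ replace (sinpi e / e - 1)%C with ((sinpi e - e) / e)%C by (field; exact Ne).
  rewrite Cmod_div, Ce by exact Ne; apply Rmult_le_reg_r with e; [lra|].
  unfold Rdiv; rewrite Rmult_assoc, Rinv_l, Rmult_1_r by lra; simpl in *; lra. }
split; [exact B|].
assert (t := Cmod_triangle (sinpi e / e - 1) 1).
replace (sinpi e / e - 1 + 1)%C with (sinpi e / e)%C in t by ring.
rewrite Cmod_1 in t; simpl in *; nra.
Qed.

(** * The root near [(0, 0)] *)

(** The limit equation [(1 + u) * u = 2] has the roots 1 and -2. The root 1 means [beta = 0], a zero
    of [F] for every [s]; the root -2 gives [beta = s - s * u], about [3 * s]. *)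
Lemma root_near_0 : exists C0 eta : R, 0 <= C0 /\ 0 < eta <= 1 /\
  forall s, 0 < s <= eta -> exists beta : C,
    F_defined s beta /\ F s beta = 0%C /\ Cmod (beta - 3 * s) <= C0 * s ^ 2.
Proof.
destruct gamma_quot_local as [M [rho [M1 [Hrho HQ]]]].
destruct (scaled_root (4 * M) ltac:(lra)) as [Lam [HLam HS]].
(* The four limits serve the sine bounds, the inclusion of [s * u] in the disc of radius [rho] when
   [Cmod u <= 3], the threshold of [scaled_root], and a residual [4000 * M * s] of at most 1/16.
   Doubling the residual constant gives [C0]. *)
set (eta := Rmin (Rmin (1 / 100) (rho / 4)) (Rmin Lam (/ (64000 * M)))).
assert (p1 : 0 < / (64000 * M)) by (apply Rinv_0_lt_compat; lra).
assert (He : 0 < eta) by (unfold eta; repeat apply Rmin_glb_lt; lra).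
exists (8000 * M), eta; split; [lra|]; split.
{ split; [exact He|]; unfold eta; generalize (Rmin_l (Rmin (1 / 100) (rho / 4)) (Rmin Lam (/ (64000 * M)))),
    (Rmin_l (1 / 100) (rho / 4)); lra. }
intros s [s0 Hs].
assert (s1 : s <= 1 / 100) by (eapply Rle_trans; [exact Hs|]; unfold eta; eapply Rle_trans; [apply Rmin_l|apply Rmin_l]).
assert (s2 : s <= rho / 4) by (eapply Rle_trans; [exact Hs|]; unfold eta; eapply Rle_trans; [apply Rmin_l|apply Rmin_r]).
assert (s3 : s <= Lam) by (eapply Rle_trans; [exact Hs|]; unfold eta; eapply Rle_trans; [apply Rmin_r|apply Rmin_l]).
assert (s4 : s <= / (64000 * M)) by (eapply Rle_trans; [exact Hs|]; unfold eta; eapply Rle_trans; [apply Rmin_r|apply Rmin_r]).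
assert (s5 : 4000 * M * s <= 1 / 16).
{ apply (Rmult_le_compat_l (4000 * M)) in s4; [|lra].
  eapply Rle_trans; [exact s4|right; field; lra]. }
clearbody eta.
assert (Cs : Cmod s = s) by (apply Cmod_pos; lra).
assert (Ns : RtoC s <> 0%C) by (apply RtoC_neq0; lra).
assert (As : Rabs s = s) by (apply Rabs_pos_eq; lra).
destruct (HQ s ltac:(lra)) as [G2 [QB [QL Q1]]]; rewrite As in Q1.
destruct (sinpi_ratio s ltac:(lra)) as [R1 R2].
set (kap := (sinpi s / s)%C) in *.
assert (B : Cmod ((1 + -2) * (sinpi (s * -2) / s) + - 2 * (kap * gamma_quot s (s * -2)))
  <= 4000 * M * s).
(* At [u = -2] the quadratic part vanishes exactly; what is left are the errors of the sine, of
   [kap] and of the Gamma quotient. *)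
{ replace ((1 + -2) * (sinpi (s * -2) / s) + - 2 * (kap * gamma_quot s (s * -2)))%C with
    (- ((sinpi (s * -2) - s * -2) / s) - 2 * ((kap - 1) * gamma_quot s (s * -2)
      + (gamma_quot s (s * -2) - 1)))%C by (field; exact Ns).
  assert (C2 : Cmod (s * -2) = 2 * s).
  { rewrite Cmod_mult, Cs, Cmod_R; unfold Rabs; destruct Rcase_abs; lra. }
  assert (b1 : Cmod ((sinpi (s * -2) - s * -2) / s) <= 2560 * s ^ 2).
  { rewrite Cmod_div, Cs by exact Ns; apply Rmult_le_reg_r with s; [lra|].
    unfold Rdiv; rewrite Rmult_assoc, Rinv_l, Rmult_1_r by lra.
    eapply Rle_trans; [apply sinpi_cubic; lra|]; rewrite C2; right; ring. }
  assert (b2 := QB (s * -2)%C ltac:(lra)); assert (b3 := Q1 (s * -2)%C ltac:(lra)).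
  rewrite C2 in b3.
  assert (b4 := Rmult_le_compat _ _ _ _ (Cmod_ge_0 _) (Cmod_ge_0 _) R1 b2).
  eapply Rle_trans; [apply Cmod_sub_le|]; rewrite Cmod_opp, Cmod_mult, (Cmod_pos 2) by lra.
  match goal with |- _ + 2 * Cmod (?p + ?q) <= _ => assert (t := Cmod_triangle p q) end.
  rewrite Cmod_mult in t.
  assert (sq : s ^ 2 <= s * (1 / 100)) by (simpl; nra).
  assert (s <= M * s) by nra.
  assert (0 <= M * (s * (1 / 100) - s ^ 2)) by (apply Rmult_le_pos; lra).
  nra. }
destruct (HS s 1%C (-2)%C (fun u => - 2 * (kap * gamma_quot s (s * u)))%C) as [u [Hu1 Hu2]].
- lra.
- rewrite Cmod_1; lra.
- rewrite Cmod_R; unfold Rabs; destruct Rcase_abs; lra.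
- replace (1 + 2 * -2)%C with (RtoC (-3)) by (rewrite <- RtoC_mult, <- RtoC_plus; f_equal; ring).
  rewrite Cmod_R; unfold Rabs; destruct Rcase_abs; lra.
- intros x y Hx Hy.
  replace (- 2 * (kap * gamma_quot s (s * x)) - - 2 * (kap * gamma_quot s (s * y)))%C
    with (- (2 * (kap * (gamma_quot s (s * x) - gamma_quot s (s * y)))))%C by ring.
  rewrite Cmod_opp, !Cmod_mult, (Cmod_pos 2) by lra.
  assert (h := QL (s * x)%C (s * y)%C).
  replace (s * x - s * y)%C with (s * (x - y))%C in h by ring.
  rewrite !Cmod_mult, Cs in h.
  specialize (h ltac:(nra) ltac:(nra)).
  assert (h' := Rmult_le_compat _ _ _ _ (Cmod_ge_0 _) (Cmod_ge_0 _) R2 h); lra.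
- cbv beta; lra.
- assert (Bu : Cmod (u + 2) <= 8000 * M * s).
  { replace (u + 2)%C with (u - -2)%C by ring; lra. }
  assert (Bu3 : Cmod u <= 3).
  { assert (h := Cmod_triangle (u + 2) (- RtoC 2)).
    replace (u + 2 + - RtoC 2)%C with u in h by ring; rewrite Cmod_opp, (Cmod_pos 2) in h; lra. }
  assert (Bsu : Cmod (s * u) <= 1 / 4) by (rewrite Cmod_mult, Cs; nra).
  exists (s - s * u)%C; split; [|split].
  + apply (F_defined_near s _ (- (s + s * u))%C); [|ring|lra].
    rewrite Cmod_opp; eapply Rle_lt_trans; [apply Cmod_triangle|]; rewrite Cmod_mult, Cs; nra.
  + rewrite F_near_0 by (assumption || lra).
    transitivity (PI * (s * s * ((1 + u) * (sinpi (s * u) / s) + - 2 * (kap * gamma_quot s (s * u)))))%C.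
    * unfold kap; field; exact Ns.
    * rewrite Hu1; ring.
  + replace (s - s * u - 3 * s)%C with (- (s * (u + 2)))%C by ring.
    rewrite Cmod_opp, Cmod_mult, Cs; simpl; nra.
Qed.

(** * The two roots near [(1, 2)] *)

Lemma one_sub_double_ge (e : R) : 0 <= e <= 1 / 4 -> 1 / 2 <= Cmod (1 - 2 * e).
Proof. intros He; rewrite <- RtoC_mult, <- RtoC_minus, Cmod_pos; lra. Qed.

Lemma cubic_factor_le (e : R) (x : C) :
  0 <= e <= 1 / 4 -> Cmod x <= 1 / 4 -> Cmod (cubic_factor e x) <= 12.
Proof.
intros He Hx; unfold cubic_factor; replace 12 with (6 / (1 / 2)) by field.
apply Cmod_div_le; [|lra|apply one_sub_double_ge, He].
assert (h := Cmod_sub_le x e); rewrite (Cmod_pos e) in h by lra.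
assert (t1 := Cmod_triangle 1 (x - e)); assert (t2 := Cmod_triangle 2 (x - e)).
rewrite (Cmod_pos 1) in t1 by lra; rewrite (Cmod_pos 2) in t2 by lra.
rewrite Cmod_mult; replace 6 with (2 * 3) by ring.
apply Rmult_le_compat; try apply Cmod_ge_0; lra.
Qed.

Lemma cubic_factor_lip (e : R) (x y : C) :
  0 <= e <= 1 / 4 -> Cmod x <= 1 / 4 -> Cmod y <= 1 / 4 ->
  Cmod (cubic_factor e x - cubic_factor e y) <= 8 * Cmod (x - y).
Proof.
intros He Hx Hy; assert (N := Cmod_ge_half_neq0 _ (one_sub_double_ge e He)).
unfold cubic_factor.
match goal with |- Cmod ?t <= _ =>
  replace t with ((x - y) * (3 + x + y - 2 * e) / (1 - 2 * e))%C by (field; exact N) end.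
replace (8 * Cmod (x - y)) with (Cmod (x - y) * 4 / (1 / 2)) by field.
apply Cmod_div_le; [|lra|apply one_sub_double_ge, He].
rewrite Cmod_mult; apply Rmult_le_compat_l; [apply Cmod_ge_0|].
eapply Rle_trans; [apply Cmod_sub_le|].
assert (t1 := Cmod_triangle (3 + x) y); assert (t2 := Cmod_triangle 3 x).
rewrite (Cmod_pos 3) in t2 by lra; rewrite <- RtoC_mult, (Cmod_pos (2 * e)) by lra; lra.
Qed.

(** The parameter is [delta = sqrt (1 - s)], in which the equation depends on its parameter without
    square roots. An error of order [delta ^ 2] in [u] becomes [delta ^ 3] in [beta], which is
    [o(1 - s)]; an error of order [delta] in [u] would be too coarse. *)
Lemma root_near_1 : exists C0 eta : R, 0 <= C0 /\ 0 < eta <= 1 / 10 /\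
  forall (sgn delta : R), sgn = 1 \/ sgn = -1 -> 0 < delta <= eta -> exists beta : C,
    F_defined (1 - delta ^ 2) beta /\ F (1 - delta ^ 2) beta = 0%C /\
    Cmod (beta - (2 + sgn * Ci * sqrt 2 * delta - 3 * (delta ^ 2)%R)) <= C0 * delta ^ 3.
Proof.
destruct gamma_quot_local as [M [rho [M1 [Hrho HQ]]]].
(* The Lipschitz constant of [k]: [kap] is at most 2, and the product rule for [cubic_factor] and
   [gamma_quot] gives [12 * M + 8 * M]. *)
destruct (scaled_root (40 * M) ltac:(lra)) as [Lam [HLam HS]].
set (eta := Rmin (Rmin (1 / 100) (rho / 4)) (Rmin Lam (/ (320000 * M)))).
assert (p1 : 0 < / (320000 * M)) by (apply Rinv_0_lt_compat; lra).
assert (He : 0 < eta) by (unfold eta; repeat apply Rmin_glb_lt; lra).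
exists (40000 * M), eta; split; [lra|].
assert (Heta : eta <= 1 / 100 /\ eta <= rho / 4 /\ eta <= Lam /\ eta <= / (320000 * M)).
{ unfold eta; repeat split.
  - eapply Rle_trans; [apply Rmin_l|apply Rmin_l].
  - eapply Rle_trans; [apply Rmin_l|apply Rmin_r].
  - eapply Rle_trans; [apply Rmin_r|apply Rmin_l].
  - eapply Rle_trans; [apply Rmin_r|apply Rmin_r]. }
clearbody eta; destruct Heta as [E1 [E2 [E3 E4]]].
split; [lra|].
intros sgn d Hsgn [d0 Hd].
assert (E5 : 20000 * M * d <= 1 / 16).
{ assert (h : 20000 * M * d <= 20000 * M * / (320000 * M)) by (apply Rmult_le_compat_l; lra).
  eapply Rle_trans; [exact h|right; field; lra]. }
set (e := d ^ 2).
assert (Ee : e = d * d) by (unfold e; ring).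
assert (e0 : 0 < e) by (rewrite Ee; nra).
assert (e1 : e <= d * (1 / 100)) by (rewrite Ee; nra).
assert (Cd : Cmod d = d) by (apply Cmod_pos; lra).
assert (Nd : RtoC d <> 0%C) by (apply RtoC_neq0; lra).
assert (Ce : Cmod e = e) by (apply Cmod_pos; lra).
assert (Ne : RtoC e <> 0%C) by (apply RtoC_neq0; lra).
assert (Ae : Rabs (- e) = e) by (rewrite Rabs_Ropp; apply Rabs_pos_eq; lra).
assert (CE : RtoC e = (d * d)%C) by (rewrite Ee, RtoC_mult; reflexivity).
clearbody e.
destruct (HQ (- e) ltac:(lra)) as [G2 [QB [QL Q1]]]; rewrite Ae in Q1.
destruct (sinpi_ratio e ltac:(lra)) as [R1 R2].
set (kap := (sinpi e / e)%C) in *.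
set (v0 := (sgn * Ci * sqrt 2)%C).
assert (s2 : sqrt 2 * sqrt 2 = 2) by (apply sqrt_sqrt; lra).
assert (s2p : 1 <= sqrt 2 <= 3 / 2).
{ assert (q := sqrt_pos 2); split; nra. }
assert (v0sq : (v0 * v0 = -2)%C).
{ unfold v0; transitivity (Ci * Ci * (sgn * sgn * (sqrt 2 * sqrt 2))%R)%C.
  - rewrite !RtoC_mult; ring.
  - rewrite Ci_sqr, s2; replace (sgn * sgn) with 1 by (destruct Hsgn; subst; ring).
    rewrite <- RtoC_mult; f_equal; ring. }
assert (Cv0 : Cmod v0 = sqrt 2).
{ unfold v0; rewrite !Cmod_mult, Cmod_Ci, (Cmod_pos (sqrt 2)), Cmod_R by lra.
  replace (Rabs sgn) with 1; [ring|].
  destruct Hsgn; subst; unfold Rabs; destruct Rcase_abs; lra. }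
clearbody v0.
(* To first order in [d] the equation is [(d + u) * u + 2 + 3 * d * v0 = 0]. Putting
   [u = v0 + d * w] with [v0 * v0 = -2] leaves [2 * w + 1 + 3 = 0], so [w = -2]. *)
set (c := (v0 - 2 * d)%C).
assert (C2d : Cmod (2 * d) = 2 * d) by (rewrite <- RtoC_mult, Cmod_pos; lra).
assert (Cc : Cmod c <= 2) by (unfold c; generalize (Cmod_sub_le v0 (2 * d)); lra).
set (k := fun u : C => (kap * (cubic_factor e (d * u) * gamma_quot (- e) (d * u)))%C).
assert (Bsm : forall u, Cmod u <= 3 -> Cmod (d * u) <= rho /\ Cmod (d * u) <= 1 / 4).
{ intros u Hu; rewrite Cmod_mult, Cd; generalize (Cmod_ge_0 u); nra. }
assert (B : Cmod ((d + c) * (sinpi (d * c) / d) + k c) <= 20000 * M * d ^ 2).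
{ destruct (Bsm c ltac:(lra)) as [c1 c2].
  set (P := cubic_factor e (d * c)) in *; set (Q := gamma_quot (- e) (d * c)) in *.
  (* The polynomial part [(d + c) * c + 2 + 3 * d * v0] reduces to [2 * d ^ 2]; the other terms
     isolate the errors of the sine, of [kap], of the Gamma quotient and of the rational factor. *)
  replace ((d + c) * (sinpi (d * c) / d) + k c)%C with
   ((d + c) * ((sinpi (d * c) - d * c) / d) + ((d + c) * c + (2 + 3 * (d * v0)))
    + ((kap - 1) * (P * Q) + (P * (Q - 1) + (P - (2 + 3 * (d * v0))))))%C
   by (unfold k; fold P; fold Q; field; exact Nd).
  assert (b1 : Cmod ((d + c) * ((sinpi (d * c) - d * c) / d)) <= 3 * (2560 * d ^ 2)).
  { rewrite Cmod_mult; apply Rmult_le_compat; try apply Cmod_ge_0.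
    - generalize (Cmod_triangle d c); lra.
    - rewrite Cmod_div, Cd by exact Nd; apply Rmult_le_reg_r with d; [lra|].
      unfold Rdiv; rewrite Rmult_assoc, Rinv_l, Rmult_1_r by lra.
      eapply Rle_trans; [apply sinpi_cubic; lra|]; rewrite Cmod_mult, Cd.
      replace (320 * (d * Cmod c) ^ 3) with (320 * d ^ 3 * Cmod c ^ 3) by ring.
      replace (2560 * d ^ 2 * d) with (320 * d ^ 3 * 2 ^ 3) by ring.
      apply Rmult_le_compat_l; [assert (0 <= d ^ 3) by (apply pow_le; lra); lra|].
      apply pow_incr; split; [apply Cmod_ge_0|exact Cc]. }
  assert (b2 : Cmod ((d + c) * c + (2 + 3 * (d * v0))) <= 2 * d ^ 2).
  { replace ((d + c) * c + (2 + 3 * (d * v0)))%C with (v0 * v0 + 2 + 2 * (d * d))%C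
      by (unfold c; ring).
    rewrite v0sq; replace (-2 + 2 + 2 * (d * d))%C with (2 * e)%C by (rewrite CE; ring).
    rewrite Cmod_mult, Ce, Cmod_pos by lra; rewrite Ee; lra. }
  assert (bP := cubic_factor_le e (d * c) ltac:(lra) c2); fold P in bP.
  assert (bQ := QB _ c1); assert (bQ1 := Q1 _ c1); fold Q in bQ, bQ1.
  assert (b3 : Cmod ((kap - 1) * (P * Q)) <= 320 * e ^ 2 * (12 * M)).
  { rewrite !Cmod_mult; apply Rmult_le_compat; try apply Cmod_ge_0; [|exact R1|].
    - apply Rmult_le_pos; apply Cmod_ge_0.
    - apply Rmult_le_compat; try apply Cmod_ge_0; assumption. }
  assert (b4 : Cmod (P * (Q - 1)) <= 12 * (M * (5 * d ^ 2))).
  { rewrite !Cmod_mult; apply Rmult_le_compat; try apply Cmod_ge_0; [exact bP|].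
    eapply Rle_trans; [exact bQ1|]; apply Rmult_le_compat_l; [lra|].
    rewrite Cmod_mult, Cd, Ee; generalize (Cmod_ge_0 c).
    intros c0; assert (Cmod c ^ 2 <= 2 ^ 2) by (apply pow_incr; lra).
    rewrite Rpow_mult_distr; assert (0 <= d ^ 2) by apply pow2_ge_0; nra. }
  assert (b5 : Cmod (P - (2 + 3 * (d * v0))) <= 100 * d ^ 2).
  { assert (N := Cmod_ge_half_neq0 _ (one_sub_double_ge e ltac:(lra))).
    set (y := (d * (v0 - 3 * d))%C).
    assert (Ey : (d * c - e)%C = y) by (unfold y, c; rewrite CE; ring).
    (* Multiplying [P] by its denominator gives [2 + 3 * y + y * y], and [3 * y] is
       [3 * d * v0 - 9 * e]; the term [2 * e * P] pays for the denominator. *)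
    replace (P - (2 + 3 * (d * v0)))%C with (2 * e * P + (y * y - 9 * e))%C.
    - assert (Cy : Cmod y <= 2 * d).
      { unfold y; rewrite Cmod_mult, Cd.
        assert (h := Cmod_sub_le v0 (3 * d)).
        rewrite <- RtoC_mult, (Cmod_pos (3 * d)), RtoC_mult in h by lra; nra. }
      eapply Rle_trans; [apply Cmod_triangle|].
      assert (h := Cmod_sub_le (y * y) (9 * e)).
      rewrite !Cmod_mult, Ce, (Cmod_pos 9) in h by lra.
      rewrite !Cmod_mult, Ce, (Cmod_pos 2) by lra.
      assert (Cmod y * Cmod y <= 2 * d * (2 * d)) by (apply Rmult_le_compat; try apply Cmod_ge_0; lra).
      assert (2 * e * Cmod P <= 2 * e * 12) by (apply Rmult_le_compat_l; lra).
      rewrite Ee in *; simpl; lra.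
    - assert (EP : (P * (1 - 2 * e) = (1 + y) * (2 + y))%C).
      { unfold P, cubic_factor; rewrite Ey; field; exact N. }
      replace P with (P * (1 - 2 * e) + 2 * e * P)%C at 2 by ring.
      rewrite EP; unfold y; rewrite CE; ring. }
  eapply Rle_trans; [apply Cmod_triangle|].
  eapply Rle_trans; [apply Rplus_le_compat_r, Cmod_triangle|].
  eapply Rle_trans; [apply Rplus_le_compat_l, Cmod_triangle|].
  eapply Rle_trans; [apply Rplus_le_compat_l, Rplus_le_compat_l, Cmod_triangle|].
  assert (d20 : 0 <= d ^ 2) by apply pow2_ge_0.
  assert (ed : e ^ 2 <= d ^ 2).
  { apply pow_incr; lra. }
  assert (d ^ 2 <= M * d ^ 2) by nra.
  assert (e ^ 2 * M <= d ^ 2 * M) by (apply Rmult_le_compat_r; lra).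
  lra. }
assert (B16 : Cmod ((d + c) * (sinpi (d * c) / d) + k c) <= 1 / 16).
{ eapply Rle_trans; [exact B|]; simpl; nra. }
destruct (HS d d c k) as [u [Hu1 Hu2]]; try lra.
- replace (d + 2 * c)%C with (2 * v0 - 3 * d)%C by (unfold c; ring).
  assert (h := Cmod_sub_ge (2 * v0) (3 * d)).
  rewrite !Cmod_mult, Cv0, Cd, (Cmod_pos 2), (Cmod_pos 3) in h by lra; lra.
- intros x y Hx Hy.
  destruct (Bsm x Hx) as [x1 x2]; destruct (Bsm y Hy) as [y1 y2].
  unfold k.
  assert (hP := cubic_factor_lip e _ _ ltac:(lra) x2 y2).
  assert (hQ := QL _ _ x1 y1).
  assert (bP := cubic_factor_le e _ ltac:(lra) x2); assert (bQ := QB _ y1).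
  set (Px := cubic_factor e (d * x)) in *; set (Py := cubic_factor e (d * y)) in *.
  set (Qx := gamma_quot (- e) (d * x)) in *; set (Qy := gamma_quot (- e) (d * y)) in *.
  replace (d * x - d * y)%C with (d * (x - y))%C in hP, hQ by ring.
  rewrite (Cmod_mult d), Cd in hP, hQ.
  replace (kap * (Px * Qx) - kap * (Py * Qy))%C with
    (kap * (Px * (Qx - Qy) + (Px - Py) * Qy))%C by ring.
  rewrite Cmod_mult.
  assert (t : Cmod (Px * (Qx - Qy) + (Px - Py) * Qy) <= 20 * M * (d * Cmod (x - y))).
  { eapply Rle_trans; [apply Cmod_triangle|]; rewrite !Cmod_mult.
    assert (h1 := Rmult_le_compat _ _ _ _ (Cmod_ge_0 _) (Cmod_ge_0 _) bP hQ).
    assert (h2 := Rmult_le_compat _ _ _ _ (Cmod_ge_0 _) (Cmod_ge_0 _) hP bQ).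
    lra. }
  assert (h := Rmult_le_compat _ _ _ _ (Cmod_ge_0 _) (Cmod_ge_0 _) R2 t); lra.
- assert (Bu : Cmod (u - c) <= 40000 * M * d ^ 2) by lra.
  assert (Bu3 : Cmod u <= 3).
  { assert (h := Cmod_triangle (u - c) c); replace (u - c + c)%C with u in h by ring.
    assert (40000 * M * d ^ 2 <= 1 / 8) by (simpl; nra); lra. }
  destruct (Bsm u Bu3) as [u1 u2].
  assert (u3 : Cmod (d * u) <= 3 / 100) by (rewrite Cmod_mult, Cd; generalize (Cmod_ge_0 u); nra).
  exists (2 - e + d * u)%C; split; [|split].
  + apply (F_defined_near _ _ (e + d * u)%C); [|rewrite RtoC_minus; ring|lra].
    eapply Rle_lt_trans; [apply Cmod_triangle|]; rewrite Ce; lra.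
  + rewrite F_near_1 by (lra || (rewrite <- ?RtoC_opp; assumption)).
    transitivity (- (PI * (e * ((d + u) * (sinpi (d * u) / d) + k u))))%C.
    * unfold k, kap, cubic_factor.
      assert (N := Cmod_ge_half_neq0 _ (one_sub_double_ge e ltac:(lra))).
      rewrite CE in N |- *.
      field; repeat split; assumption.
    * rewrite Hu1; ring.
  (* Since [d * c = v0 * d - 2 * e], the shift by [- e] in [beta] completes the coefficient -3. *)
  + replace (2 - e + d * u - (2 + v0 * d - 3 * e))%C with (d * (u - c))%C
      by (unfold c; rewrite CE; ring).
    rewrite Cmod_mult, Cd; simpl in *; nra.
Qed.

(** * Choice of the branches and the asymptotics *)

Lemma little_o_intro (D : R -> Prop) (a : R) (f : R -> C) (g : R -> R) :
  (forall eps : posreal, exists eta : posreal,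
     forall s, D s -> Rabs (s - a) < eta -> Cmod (f s) <= eps * Rabs (g s)) ->
  little_o D a f g.
Proof.
intros H eps; destruct (H eps) as [eta He]; exists eta; intros s Hs HD.
apply (He s HD Hs).
Qed.

Theorem mainTheorem7 :
  exists eta1 eta2 : R,
    0 < eta1 <= 1 /\ 0 < eta2 <= 1 /\
    (forall sgn : R, sgn = 1 \/ sgn = -1 ->
       exists beta1 : R -> C,
         (forall s : R, 1 - eta1 <= s <= 1 ->
            F_defined s (beta1 s) /\ F s (beta1 s) = 0%C) /\
         little_o (fun s => 1 - eta1 <= s <= 1) 1
           (fun s => (beta1 s -
              (2 + sgn * Ci * sqrt (2 * (1 - s)) - 3 * (1 - s)))%C)
           (fun s => 1 - s)) /\
    (exists beta2 : R -> C,
       (forall s : R, 0 <= s <= eta2 ->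
          F_defined s (beta2 s) /\ F s (beta2 s) = 0%C) /\
       little_o (fun s => 0 <= s <= eta2) 0
         (fun s => (beta2 s - 3 * s)%C)
         (fun s => s)).
Proof.
destruct root_near_1 as [C1 [h1 [C1p [h1p H1]]]].
destruct root_near_0 as [C2 [h2 [C2p [h2p H2]]]].
(* The square converts the range of [delta = sqrt (1 - s)] into a range of [s]. *)
exists (h1 ^ 2), h2; split; [split; nra|]; split; [lra|]; split.
- intros sgn Hsgn.
  (* The range condition sits under the existential so that choice yields a function on all of [R];
     outside the range 0 is a dummy value. *)
  assert (K : forall s : R, exists beta : C, 1 - h1 ^ 2 <= s <= 1 ->
    F_defined s beta /\ F s beta = 0%C /\
    Cmod (beta - (2 + sgn * Ci * sqrt (2 * (1 - s)) - 3 * (1 - s)))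
      <= C1 * sqrt (1 - s) ^ 3).
  { intros s; destruct (Rlt_le_dec s 1) as [hs|hs].
    - destruct (Rle_lt_dec (1 - h1 ^ 2) s) as [hs'|hs'].
      + assert (q : sqrt (1 - s) ^ 2 = 1 - s) by (apply pow2_sqrt; lra).
        assert (q0 : 0 < sqrt (1 - s)) by (apply sqrt_lt_R0; lra).
        destruct (H1 sgn (sqrt (1 - s)) Hsgn) as [b [b1 [b2 b3]]].
        { split; [exact q0|]; assert (sqrt (1 - s) ^ 2 <= h1 ^ 2) by lra; nra. }
        rewrite q in b1, b2, b3; replace (1 - (1 - s)) with s in b1, b2 by ring.
        exists b; intros _; split; [exact b1|split; [exact b2|]].
        rewrite sqrt_mult, RtoC_mult by lra.
        replace (sgn * Ci * (sqrt 2 * sqrt (1 - s)))%C with (sgn * Ci * sqrt 2 * sqrt (1 - s))%C by ring.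
        rewrite RtoC_minus in b3; exact b3.
      + exists 0%C; intros; lra.
    (* The endpoint [delta = 0] is outside [root_near_1]; at [s = 1], [beta = 2] both [2 * s - beta]
       and [sin (PI * s)] vanish. *)
    - exists 2%C; intros [_ hs']; replace s with 1 by lra.
      split; [|split].
      + apply (F_defined_near 1 _ 0%C); [rewrite Cmod_0; lra|ring|lra].
      + unfold F.
        replace (PI * 1)%C with (0 + PI)%C by ring.
        rewrite Csin_plus_pi, Csin_0; unfold Cdiv; ring.
      + replace (2 * (1 - 1)) with 0 by ring; rewrite Rminus_diag, sqrt_0.
        match goal with |- Cmod ?t <= _ => replace t with (RtoC 0) by ring end.
        rewrite Cmod_0; simpl; lra. }
  exists (fun s => proj1_sig (constructive_indefinite_description _ (K s))); split.
  + intros s Hs; destruct (constructive_indefinite_description _ (K s)) as [b Hb]; simpl.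
    destruct (Hb Hs) as [b1 [b2 _]]; auto.
  + apply little_o_intro; intros eps.
    assert (ep := cond_pos eps).
    assert (r0 : 0 < eps / (C1 + 1)) by (apply Rdiv_lt_0_compat; lra).
    (* This gives [sqrt (1 - s) <= eps / (C1 + 1)], so one factor of the cubic error is absorbed by
       [eps] and the other two make [1 - s]. The added 1 covers [C1 = 0]. *)
    exists (mkposreal ((eps / (C1 + 1)) ^ 2) ltac:(apply pow_lt; exact r0)).
    intros s Hs Hc; simpl in Hc.
    destruct (constructive_indefinite_description _ (K s)) as [b Hb]; simpl.
    destruct (Hb Hs) as [_ [_ b3]].
    eapply Rle_trans; [exact b3|].
    assert (q : sqrt (1 - s) ^ 2 = 1 - s) by (apply pow2_sqrt; lra).
    assert (q0 := sqrt_pos (1 - s)).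
    rewrite Rabs_minus_sym, (Rabs_pos_eq (1 - s)) in Hc by lra.
    rewrite (Rabs_pos_eq (1 - s)) by lra.
    assert (ql : sqrt (1 - s) <= eps / (C1 + 1)).
    { rewrite <- q in Hc; simpl in Hc; nra. }
    replace (C1 * sqrt (1 - s) ^ 3) with (C1 * sqrt (1 - s) * sqrt (1 - s) ^ 2) by ring.
    rewrite q; apply Rmult_le_compat_r; [lra|].
    apply Rle_trans with ((C1 + 1) * (eps / (C1 + 1))); [|right; field; lra].
    apply Rmult_le_compat; lra.
- assert (K : forall s : R, exists beta : C, 0 <= s <= h2 ->
    F_defined s beta /\ F s beta = 0%C /\ Cmod (beta - 3 * s) <= C2 * s ^ 2).
  { intros s; destruct (Rlt_le_dec 0 s) as [hs|hs].
    - destruct (Rle_lt_dec s h2) as [hs'|hs'].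
      + destruct (H2 s (conj hs hs')) as [b Hb]; exists b; intros _; exact Hb.
      + exists 0%C; intros; lra.
    (* At [s = 0], [beta = 0] the factors [2 * s - beta] and [sin (PI * s)] are both 0. *)
    - exists 0%C; intros [hs' _]; replace s with 0 by lra; split; [|split].
      + apply (F_defined_near 0 _ 0%C); [rewrite Cmod_0; lra|ring|lra].
      + unfold F; rewrite (Cmult_0_r PI), Csin_0; unfold Cdiv; ring.
      + replace (0 - 3 * 0)%C with (RtoC 0) by ring; rewrite Cmod_0; simpl; lra. }
  exists (fun s => proj1_sig (constructive_indefinite_description _ (K s))); split.
  + intros s Hs; destruct (constructive_indefinite_description _ (K s)) as [b Hb]; simpl.
    destruct (Hb Hs) as [b1 [b2 _]]; auto.
  + apply little_o_intro; intros eps.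
    assert (ep := cond_pos eps).
    assert (r0 : 0 < eps / (C2 + 1)) by (apply Rdiv_lt_0_compat; lra).
    exists (mkposreal _ r0); intros s Hs Hc; simpl in Hc.
    destruct (constructive_indefinite_description _ (K s)) as [b Hb]; simpl.
    destruct (Hb Hs) as [_ [_ b3]].
    eapply Rle_trans; [exact b3|].
    rewrite Rminus_0_r in Hc; rewrite Rabs_pos_eq in Hc |- * by lra.
    replace (C2 * s ^ 2) with (C2 * s * s) by ring.
    apply Rmult_le_compat_r; [lra|].
    apply Rle_trans with ((C2 + 1) * (eps / (C2 + 1))); [|right; field; lra].
    apply Rmult_le_compat; lra.
Qed.
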